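(* Over $\mathsf{RCA}_0$, $\mathsf{EM}$ does not imply $\mathsf{SADS}$ (and hence neither $\mathsf{EM}$ nor $\mathsf{SEM}$ implies either $\mathsf{ADS}$ or $\mathsf{SADS}$).
   Context: All principles are statements of second order arithmetic; infinite structures have domain $\mathbb{N}$. An infinite tournament is an irreflexive binary relation $T$ on $\mathbb{N}$ such that for all $x\neq y$ exactly one of $T(x,y)$, $T(y,x)$ holds. It is stable if for all $x$ there is a $y$ such that either $T(x,z)$ holds for all $z>y$ or $T(z,x)$ holds for all $z>y$. An infinite transitive subtournament of $T$ is an infinite set $S$ on which the relation $T$ is transitive. $\mathsf{EM}$: every infinite tournament contains an infinite transitive subtournament. $\mathsf{SEM}$: every infinite stable tournament contains an infinite transitive subtournament. $\mathsf{ADS}$: for every infinite linear order $L=(\mathbb{N},<_L)$ there is an $f:\mathbb{N}\to\mathbb{N}$ with either $f(n)<_L f(m)$ for all $n<m$, or $f(n)>_L f(m)$ for all $n<m$. An infinite linear order $L$ is stable if it has order type $\omega+\omega^*$, which means: for every $x$ there is a $y$ such that either $x<_L z$ for all $z>y$ or $z<_L x$ for all $z>y$. $\mathsf{SADS}$: $\mathsf{ADS}$ restricted to infinite stable linear orders. *)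

(* Defs.v *)
From Stdlib Require Import List.
Import ListNotations.

(* The two-sorted language of second order arithmetic.  Number variables and
   set variables are two separate families of de Bruijn indices: [AllN]/[ExN]
   bind number index 0 and leave set indices alone, [AllS]/[ExS] bind set
   index 0 and leave number indices alone.  Equality is primitive for numbers
   only. *)

Inductive term : Type :=
| Var (n : nat)
| Zero
| One
| Add (s t : term)
| Mul (s t : term).

Inductive form : Type :=
| Eq (s t : term)
| Lt (s t : term)
| Mem (t : term) (X : nat)
| Bot
| Imp (A B : form)
| And (A B : form)
| Or (A B : form)
| AllN (A : form)
| ExN (A : form)
| AllS (A : form)
| ExS (A : form).

Declare Scope fo_scope.
Delimit Scope fo_scope with fo.
Bind Scope fo_scope with term form.

Notation "0" := Zero : fo_scope.
Notation "1" := One : fo_scope.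
Notation "s + t" := (Add s t) : fo_scope.
Notation "s * t" := (Mul s t) : fo_scope.
Notation "s = t" := (Eq s t) : fo_scope.
Notation "s < t" := (Lt s t) : fo_scope.
Notation "A -> B" := (Imp A B) : fo_scope.
Notation "A /\ B" := (And A B) : fo_scope.
Notation "A \/ B" := (Or A B) : fo_scope.
Notation "~ A" := (Imp A Bot) : fo_scope.
Notation "A <-> B" := (And (Imp A B) (Imp B A)) : fo_scope.

(* Simultaneous capture-avoiding substitution: [sigma] replaces number
   variables by terms, [rho] renames set variables (the only set terms). *)

Fixpoint tsubst (sigma : nat -> term) (t : term) : term :=
  match t with
  | Var n => sigma n
  | Zero => Zero
  | One => One
  | Add s t => Add (tsubst sigma s) (tsubst sigma t)
  | Mul s t => Mul (tsubst sigma s) (tsubst sigma t)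
  end.

Definition tshift : term -> term := tsubst (fun n => Var (S n)).

Definition scons {A : Type} (a : A) (f : nat -> A) (n : nat) : A :=
  match n with O => a | S k => f k end.

Definition upN (sigma : nat -> term) : nat -> term :=
  scons (Var O) (fun n => tshift (sigma n)).

Definition upS (rho : nat -> nat) : nat -> nat :=
  scons O (fun n => S (rho n)).

Fixpoint subst (sigma : nat -> term) (rho : nat -> nat) (A : form) : form :=
  match A with
  | Eq s t => Eq (tsubst sigma s) (tsubst sigma t)
  | Lt s t => Lt (tsubst sigma s) (tsubst sigma t)
  | Mem t X => Mem (tsubst sigma t) (rho X)
  | Bot => Bot
  | Imp A B => Imp (subst sigma rho A) (subst sigma rho B)
  | And A B => And (subst sigma rho A) (subst sigma rho B)
  | Or A B => Or (subst sigma rho A) (subst sigma rho B)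
  | AllN A => AllN (subst (upN sigma) rho A)
  | ExN A => ExN (subst (upN sigma) rho A)
  | AllS A => AllS (subst sigma (upS rho) A)
  | ExS A => ExS (subst sigma (upS rho) A)
  end.

Definition shiftN : form -> form := subst (fun n => Var (S n)) (fun X => X).
Definition shiftS : form -> form := subst Var S.
Definition instN (t : term) : form -> form :=
  subst (scons t Var) (fun X => X).
Definition instS (X : nat) : form -> form :=
  subst Var (scons X (fun Y => Y)).

(* Classical natural deduction with non-logical axioms [T].  Axioms are not
   shifted by the eigenvariable conditions, so the free variables of an axiom
   can be generalized: each axiom stands for its universal closure. *)

Inductive provable (T : form -> Prop) : list form -> form -> Prop :=
| p_axiom G A : T A -> provable T G A
| p_hyp G A : In A G -> provable T G A
| p_impI G A B : provable T (A :: G) B -> provable T G (Imp A B)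
| p_impE G A B : provable T G (Imp A B) -> provable T G A -> provable T G B
| p_dne G A : provable T G (Imp (Imp A Bot) Bot) -> provable T G A
| p_andI G A B : provable T G A -> provable T G B -> provable T G (And A B)
| p_andE1 G A B : provable T G (And A B) -> provable T G A
| p_andE2 G A B : provable T G (And A B) -> provable T G B
| p_orI1 G A B : provable T G A -> provable T G (Or A B)
| p_orI2 G A B : provable T G B -> provable T G (Or A B)
| p_orE G A B C :
    provable T G (Or A B) -> provable T (A :: G) C -> provable T (B :: G) C ->
    provable T G C
| p_allNI G A : provable T (map shiftN G) A -> provable T G (AllN A)
| p_allNE G A t : provable T G (AllN A) -> provable T G (instN t A)
| p_exNI G A t : provable T G (instN t A) -> provable T G (ExN A)
| p_exNE G A B :
    provable T G (ExN A) -> provable T (A :: map shiftN G) (shiftN B) ->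
    provable T G B
| p_allSI G A : provable T (map shiftS G) A -> provable T G (AllS A)
| p_allSE G A X : provable T G (AllS A) -> provable T G (instS X A)
| p_exSI G A X : provable T G (instS X A) -> provable T G (ExS A)
| p_exSE G A B :
    provable T G (ExS A) -> provable T (A :: map shiftS G) (shiftS B) ->
    provable T G B
| p_eqI G t : provable T G (Eq t t)
| p_eqE G A s t :
    provable T G (Eq s t) -> provable T G (instN s A) ->
    provable T G (instN t A).

Definition implies_over (T : form -> Prop) (A B : form) : Prop :=
  provable T [] (Imp A B).

(* Formula classes; the bound of a bounded quantifier may not contain the
   quantified variable, whence [tshift].  Set parameters are allowed. *)

Inductive Delta00 : form -> Prop :=
| d_eq s t : Delta00 (Eq s t)
| d_lt s t : Delta00 (Lt s t)
| d_mem t X : Delta00 (Mem t X)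
| d_bot : Delta00 Bot
| d_imp A B : Delta00 A -> Delta00 B -> Delta00 (Imp A B)
| d_and A B : Delta00 A -> Delta00 B -> Delta00 (And A B)
| d_or A B : Delta00 A -> Delta00 B -> Delta00 (Or A B)
| d_all t A : Delta00 A -> Delta00 (AllN (Imp (Lt (Var O) (tshift t)) A))
| d_ex t A : Delta00 A -> Delta00 (ExN (And (Lt (Var O) (tshift t)) A)).

Inductive Sigma01 : form -> Prop :=
| Sigma01_ex A : Delta00 A -> Sigma01 (ExN A).

Inductive Pi01 : form -> Prop :=
| Pi01_all A : Delta00 A -> Pi01 (AllN A).

Definition succ_inst : form -> form :=
  subst (scons (Add (Var O) One) (fun n => Var (S n))) (fun X => X).

Definition induction_axiom (A : form) : form :=
  (instN 0 A /\ AllN (A -> succ_inst A) -> AllN A)%fo.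

(* [shiftS A]: the comprehended set does not occur in [A]. *)
Definition comprehension_axiom (A B : form) : form :=
  (AllN (A <-> B) -> ExS (AllN (Mem (Var O) O <-> shiftS A)))%fo.

Local Open Scope fo_scope.

Inductive RCA0 : form -> Prop :=
| ax_succ_neq0 : RCA0 (~ (Var 0 + 1 = 0))
| ax_succ_inj : RCA0 (Var 0 + 1 = Var 1 + 1 -> Var 0 = Var 1)
| ax_add0 : RCA0 (Var 0 + 0 = Var 0)
| ax_addS : RCA0 (Var 0 + (Var 1 + 1) = (Var 0 + Var 1) + 1)
| ax_mul0 : RCA0 (Var 0 * 0 = 0)
| ax_mulS : RCA0 (Var 0 * (Var 1 + 1) = Var 0 * Var 1 + Var 0)
| ax_lt0 : RCA0 (~ (Var 0 < 0))
| ax_ltS : RCA0 (Var 0 < Var 1 + 1 <-> Var 0 < Var 1 \/ Var 0 = Var 1)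
| ax_induction A : Sigma01 A -> RCA0 (induction_axiom A)
| ax_comprehension A B :
    Sigma01 A -> Pi01 B -> RCA0 (comprehension_axiom A B).

(* A binary relation on the numbers is a set of codes of pairs, with
   (x,y) coded by the number (x+y)^2+x. *)
Definition Rel (R : nat) (s t : term) : form :=
  Mem ((s + t) * (s + t) + s) R.

(* In the formulas below the nat arguments are set indices. *)

Definition tournament (T : nat) : form :=
  AllN (~ Rel T (Var 0) (Var 0)) /\
  AllN (AllN (let x := Var 1 in let y := Var 0 in
    ~ (x = y) ->
    (Rel T x y \/ Rel T y x) /\ ~ (Rel T x y /\ Rel T y x))).

Definition linear_order (L : nat) : form :=
  AllN (~ Rel L (Var 0) (Var 0)) /\
  AllN (AllN (AllN (let x := Var 2 in let y := Var 1 in let z := Var 0 in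
    Rel L x y /\ Rel L y z -> Rel L x z))) /\
  AllN (AllN (let x := Var 1 in let y := Var 0 in
    ~ (x = y) -> Rel L x y \/ Rel L y x)).

(* The stability condition for tournaments and for linear orders alike. *)
Definition stable (R : nat) : form :=
  AllN (ExN (let x := Var 2 in let y := Var 1 in let z := Var 0 in
    AllN (y < z -> Rel R x z) \/ AllN (y < z -> Rel R z x))).

Definition infinite (X : nat) : form :=
  AllN (ExN (let x := Var 1 in let y := Var 0 in x < y /\ Mem y X)).

Definition transitive_on (T X : nat) : form :=
  AllN (AllN (AllN (let x := Var 2 in let y := Var 1 in let z := Var 0 in
    Mem x X /\ Mem y X /\ Mem z X ->
    Rel T x y /\ Rel T y z -> Rel T x z))).

Definition is_function (F : nat) : form :=
  AllN (ExN (Rel F (Var 1) (Var 0) /\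
             AllN (Rel F (Var 2) (Var 0) -> Var 0 = Var 1))).

Definition ascending (L F : nat) : form :=
  AllN (AllN (AllN (AllN (
    let n := Var 3 in let m := Var 2 in let a := Var 1 in let b := Var 0 in
    n < m -> Rel F n a -> Rel F m b -> Rel L a b)))).

Definition descending (L F : nat) : form :=
  AllN (AllN (AllN (AllN (
    let n := Var 3 in let m := Var 2 in let a := Var 1 in let b := Var 0 in
    n < m -> Rel F n a -> Rel F m b -> Rel L b a)))).

Definition EM : form :=
  AllS (tournament 0 -> ExS (infinite 0 /\ transitive_on 1 0)).

Definition SEM : form :=
  AllS (tournament 0 /\ stable 0 -> ExS (infinite 0 /\ transitive_on 1 0)).

Definition ADS : form :=
  AllS (linear_order 0 ->
        ExS (is_function 0 /\ (ascending 1 0 \/ descending 1 0))).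

Definition SADS : form :=
  AllS (linear_order 0 /\ stable 0 ->
        ExS (is_function 0 /\ (ascending 1 0 \/ descending 1 0))).

(* Main.v *)
(** The separation is witnessed by an omega-model. Its first set is a generic
    stable linear order whose [omega] and [omega^*] parts are both hyperimmune
    relative to it: every condition decides only finitely many elements and leaves an open gap, and
    the elements that enter the gap before a computation halts can still be
    put on either side of the cut. A monotone sequence would enumerate an
    unbounded subset of one of the two parts.

    Hyperimmunity of both parts is then preserved while solutions of [EM] are
    added (Patey). A condition is a finite chain with an infinite reservoir
    inside one of its intervals. If, for every 2-partition of the reservoir,
    some chain homogeneous for it makes a computation converge, then compactness
    bounds its values, hyperimmunity makes the bounded block miss the given
    part, and a chain homogeneous for the behaviour towards a thinner reservoir
    can be absorbed. Otherwise the class of partitions without such chains is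
    nonempty, and one of its members preserves hyperimmunity; a piece of it is
    a reservoir forcing divergence. *)

From Stdlib Require Import QArith Lqa List Arith Lia Cantor.
From Stdlib Require Import Classical IndefiniteDescription FunctionalExtensionality PropExtensionality.
Require Import Defs.
Import ListNotations.
Local Open Scope nat_scope.

(** * Soundness *)

Definition oracle := nat -> Prop.

Fixpoint teval (e : nat -> nat) (t : term) : nat :=
  match t with
  | Var n => e n
  | Zero => 0
  | One => 1
  | Add s t => teval e s + teval e t
  | Mul s t => teval e s * teval e t
  end.

Fixpoint sat (M : oracle -> Prop) (e : nat -> nat) (s : nat -> oracle) (A : form) : Prop :=
  match A with
  | Eq t u => teval e t = teval e u
  | Lt t u => teval e t < teval e u
  | Mem t X => s X (teval e t)
  | Bot => False
  | Imp A B => sat M e s A -> sat M e s B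
  | And A B => sat M e s A /\ sat M e s B
  | Or A B => sat M e s A \/ sat M e s B
  | AllN A => forall x, sat M (scons x e) s A
  | ExN A => exists x, sat M (scons x e) s A
  | AllS A => forall X, M X -> sat M e (scons X s) A
  | ExS A => exists X, M X /\ sat M e (scons X s) A
  end.

Lemma scons_eta {A} (a : A) (f g : nat -> A) :
  g 0 = a -> (forall n, g (S n) = f n) -> g = scons a f.
Proof. intros H0 HS; apply functional_extensionality; intros [|n]; simpl; auto. Qed.

Lemma teval_tsubst e sigma t :
  teval e (tsubst sigma t) = teval (fun n => teval e (sigma n)) t.
Proof. induction t; simpl; congruence. Qed.

Lemma sat_subst M A : forall e s sigma rho,
  sat M e s (subst sigma rho A) <->
  sat M (fun n => teval e (sigma n)) (fun X => s (rho X)) A.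
Proof.
  assert (HN : forall x e sigma,
    (fun n => teval (scons x e) (upN sigma n)) = scons x (fun n => teval e (sigma n))).
  { intros; apply scons_eta; [reflexivity|]; intros n; simpl.
    unfold tshift; rewrite teval_tsubst; reflexivity. }
  assert (HS : forall (X : oracle) s rho,
    (fun Y => scons X s (upS rho Y)) = scons X (fun Y => s (rho Y))).
  { intros; apply scons_eta; reflexivity. }
  induction A as [t u|t u|t X| |A IHA1 B IHA2|A IHA1 B IHA2|A IHA1 B IHA2|A IHA|A IHA|A IHA|A IHA];
    intros e s sigma rho; simpl; rewrite ?teval_tsubst; try tauto;
    try (rewrite IHA1, IHA2; tauto).
  - split; intros H x; specialize (H x); rewrite IHA, HN in *; auto.
  - split; intros [x H]; exists x; rewrite IHA, HN in *; auto.
  - split; intros H X HX; specialize (H X HX); rewrite IHA, HS in *; auto.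
  - split; intros [X [HX H]]; exists X; rewrite IHA, HS in *; auto.
Qed.

Lemma sat_instN M e s t A :
  sat M e s (instN t A) <-> sat M (scons (teval e t) e) s A.
Proof.
  unfold instN; rewrite sat_subst.
  rewrite (scons_eta (teval e t) e (fun n => teval e (scons t Var n))); tauto.
Qed.

Lemma sat_instS M e s X A :
  sat M e s (instS X A) <-> sat M e (scons (s X) s) A.
Proof.
  unfold instS; rewrite sat_subst.
  rewrite (scons_eta (s X) s (fun Y => s (scons X (fun Y => Y) Y))); tauto.
Qed.

Lemma sat_shiftN M x e s A : sat M (scons x e) s (shiftN A) <-> sat M e s A.
Proof. unfold shiftN; rewrite sat_subst; simpl; tauto. Qed.

Lemma sat_shiftS M X e s A : sat M e (scons X s) (shiftS A) <-> sat M e s A.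
Proof. unfold shiftS; rewrite sat_subst; simpl; tauto. Qed.

(** Quantifying over all environments matches the reading of each axiom as its universal closure. *)
Definition models (M : oracle -> Prop) (A : form) : Prop :=
  forall e s, (forall i, M (s i)) -> sat M e s A.

Lemma scons_in {M : oracle -> Prop} {X s} :
  M X -> (forall i, M (s i)) -> forall i, M (scons X s i).
Proof. intros HX Hs [|i]; simpl; auto. Qed.

Lemma soundness T M G A :
  (forall B, T B -> models M B) -> provable T G A ->
  forall e s, (forall i, M (s i)) -> (forall B, In B G -> sat M e s B) -> sat M e s A.
Proof.
  intros HT HA.
  assert (HshN : forall G e s x, (forall B, In B G -> sat M e s B) ->
    forall B, In B (map shiftN G) -> sat M (scons x e) s B).
  { intros G0 e s x H B HB; apply in_map_iff in HB; destruct HB as [C [<- HC]].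
    apply sat_shiftN; auto. }
  assert (HshS : forall G e s X, (forall B, In B G -> sat M e s B) ->
    forall B, In B (map shiftS G) -> sat M e (scons X s) B).
  { intros G0 e s X H B HB; apply in_map_iff in HB; destruct HB as [C [<- HC]].
    apply sat_shiftS; auto. }
  assert (Hcons : forall A G e s, sat M e s A -> (forall B, In B G -> sat M e s B) ->
    forall B, In B (A :: G) -> sat M e s B).
  { intros A0 G0 e s H H0 B [<-|HB]; auto. }
  induction HA as [G A HA|G A HA|G A B HA IH|G A B HA IH HA' IH'|G A HA IH|G A B HA IH HA' IH'
    |G A B HA IH|G A B HA IH|G A B HA IH|G A B HA IH|G A B C HA IH HA' IH' HA'' IH''
    |G A HA IH|G A t HA IH|G A t HA IH|G A B HA IH HA' IH'|G A HA IH|G A X HA IH|G A X HA IH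
    |G A B HA IH HA' IH'|G t|G A t u HA IH HA' IH']; intros e s Hs HG; simpl in *.
  - exact (HT A HA e s Hs).
  - auto.
  - intros HA0; apply IH; eauto.
  - exact (IH e s Hs HG (IH' e s Hs HG)).
  - apply NNPP; exact (IH e s Hs HG).
  - auto.
  - apply (IH e s Hs HG).
  - apply (IH e s Hs HG).
  - left; auto.
  - right; auto.
  - destruct (IH e s Hs HG); [apply IH'|apply IH'']; eauto.
  - intros x; apply IH; eauto.
  - apply sat_instN, (IH e s Hs HG).
  - exists (teval e t); apply sat_instN; auto.
  - destruct (IH e s Hs HG) as [x Hx].
    apply (sat_shiftN M x); apply IH'; eauto.
  - intros X HX; apply IH; eauto; apply scons_in; assumption.
  - apply sat_instS, (IH e s Hs HG), Hs.
  - exists (s X); split; [apply Hs|]; apply sat_instS; auto.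
  - destruct (IH e s Hs HG) as [X [HX H]].
    apply (sat_shiftS M X); apply IH'; eauto; apply scons_in; assumption.
  - reflexivity.
  - pose proof (IH e s Hs HG) as E; simpl in E.
    apply sat_instN; rewrite <- E; apply sat_instN, IH'; auto.
Qed.

(** A formula mentions finitely many number variables. This lets the number parameters of a
    comprehension instance be stored in a finite list. *)
Lemma sat_local A : exists N, forall M e e' s,
  (forall i, i < N -> e i = e' i) -> (sat M e s A <-> sat M e' s A).
Proof.
  assert (HT : forall t, exists N, forall e e',
    (forall i, i < N -> e i = e' i) -> teval e t = teval e' t).
  { induction t as [n| | |t [N H] u [N' H']|t [N H] u [N' H']]; simpl;
      try (exists 0; reflexivity).
    - exists (S n); intros; auto.
    - exists (N + N'); intros; erewrite H, H'; [reflexivity|..]; intros; apply H0; lia.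
    - exists (N + N'); intros; erewrite H, H'; [reflexivity|..]; intros; apply H0; lia. }
  assert (Hsc : forall N (x : nat) e e', (forall i, i < N -> e i = e' i) ->
    forall i, i < N -> scons x e i = scons x e' i).
  { intros N x e e' H [|i] Hi; simpl; auto; apply H; lia. }
  induction A as [t u|t u|t X| |A [N H] B [N' H']|A [N H] B [N' H']|A [N H] B [N' H']
                 |A [N H]|A [N H]|A [N H]|A [N H]]; simpl.
  1,2: destruct (HT t) as [N H], (HT u) as [N' H']; exists (N + N'); intros;
       rewrite (H e e'), (H' e e'); [tauto| |]; intros; apply H0; lia.
  1: destruct (HT t) as [N H]; exists N; intros; rewrite (H e e'); tauto.
  1: exists 0; tauto.
  1,2,3: exists (N + N'); intros M e e' s He;
    rewrite (H M e e'), (H' M e e'); [tauto| |]; intros; apply He; lia.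
  all: exists N; intros M e e' s He.
  - split; intros K x; specialize (K x); rewrite H in *; eauto; intros; symmetry; eauto.
  - split; intros [x K]; exists x; rewrite H in *; eauto; intros; symmetry; eauto.
  - split; intros K X HX; specialize (K X HX); rewrite H in *; eauto; intros; symmetry; eauto.
  - split; intros [X [HX K]]; exists X; rewrite H in *; eauto; intros; symmetry; eauto.
Qed.

(** * Open functionals *)

Definition agree (k : nat) (Z Z' : oracle) : Prop := forall i, i < k -> (Z i <-> Z' i).

(** Openness in Cantor space: what is kept of a halting oracle computation is its finite use. *)
Definition open (phi : oracle -> Prop) : Prop :=
  forall Z, phi Z -> exists k, forall Z', agree k Z Z' -> phi Z'.

Definition join (Z X : oracle) : oracle :=
  fun n => if Nat.even n then Z (Nat.div2 n) else X (Nat.div2 n).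

Definition left (Q : oracle) : oracle := fun n => Q (n + n).
Definition right (Q : oracle) : oracle := fun n => Q (n + n + 1).

Lemma left_join Z X : left (join Z X) = Z.
Proof.
  apply functional_extensionality; intros n; unfold left, join.
  replace (n + n) with (2 * n) by lia.
  rewrite Nat.even_even, Nat.div2_double; reflexivity.
Qed.

Lemma right_join Z X : right (join Z X) = X.
Proof.
  apply functional_extensionality; intros n; unfold right, join.
  replace (n + n + 1) with (S (2 * n)) by lia.
  rewrite Nat.even_succ, Nat.odd_even, Nat.div2_succ_double; reflexivity.
Qed.

Lemma oracle_ext (Z X : oracle) : (forall n, Z n <-> X n) -> Z = X.
Proof.
  intros H; apply functional_extensionality; intros; apply propositional_extensionality; auto.
Qed.

Lemma agree_le k k' Z Z' : k <= k' -> agree k' Z Z' -> agree k Z Z'.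
Proof. intros Hk H i Hi; apply H; lia. Qed.

Lemma agree_refl k Z : agree k Z Z.
Proof. intros i Hi; tauto. Qed.

Lemma agree_sym k Z Z' : agree k Z Z' -> agree k Z' Z.
Proof. intros H i Hi; symmetry; auto. Qed.

Lemma agree_join k Z Z' X X' :
  agree k Z Z' -> agree k X X' -> agree k (join Z X) (join Z' X').
Proof.
  intros H H' i Hi; unfold join; pose proof (Nat.div2_decr i i (le_S _ _ (le_n i))).
  destruct (Nat.even i); [apply H|apply H']; lia.
Qed.

Lemma open_const (P : Prop) : open (fun _ => P).
Proof. intros Z H; exists 0; auto. Qed.

Lemma open_and phi psi : open phi -> open psi -> open (fun Z => phi Z /\ psi Z).
Proof.
  intros H H' Z [HZ HZ']; destruct (H Z HZ) as [k Hk], (H' Z HZ') as [k' Hk'].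
  exists (k + k'); intros Y HY; split; [apply Hk|apply Hk']; revert HY; apply agree_le; lia.
Qed.

Lemma open_or phi psi : open phi -> open psi -> open (fun Z => phi Z \/ psi Z).
Proof.
  intros H H' Z [HZ|HZ]; [destruct (H Z HZ) as [k Hk]|destruct (H' Z HZ) as [k Hk]];
    exists k; auto.
Qed.

Lemma open_ex {A} (phi : A -> oracle -> Prop) :
  (forall a, open (phi a)) -> open (fun Z => exists a, phi a Z).
Proof. intros H Z [a Ha]; destruct (H a Z Ha) as [k Hk]; exists k; eauto. Qed.

Lemma open_forall_in {A} (l : list A) (phi : A -> oracle -> Prop) :
  (forall a, open (phi a)) -> open (fun Z => forall a, In a l -> phi a Z).
Proof.
  intros H; induction l as [|b l IH]; intros Z HZ; [exists 0; simpl; tauto|].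
  destruct (H b Z (HZ b (or_introl eq_refl))) as [k Hk].
  destruct (IH Z (fun a Ha => HZ a (or_intror Ha))) as [k' Hk'].
  exists (k + k'); intros Y HY a [<-|Ha]; [apply Hk|apply Hk'; auto];
    revert HY; apply agree_le; lia.
Qed.

Lemma open_forall_lt n (phi : nat -> oracle -> Prop) :
  (forall a, open (phi a)) -> open (fun Z => forall a, a < n -> phi a Z).
Proof.
  intros H Z HZ.
  destruct (open_forall_in (seq 0 n) phi H Z) as [k Hk].
  - intros a Ha; apply HZ; apply in_seq in Ha; lia.
  - exists k; intros Y HY a Ha; apply Hk; auto; apply in_seq; lia.
Qed.

Lemma open_FOP {A} (R : A -> A -> oracle -> Prop) l :
  (forall a b, open (R a b)) -> open (fun Z => ForallOrdPairs (fun a b => R a b Z) l).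
Proof.
  intros H; induction l as [|b l IH]; intros Z HZ; [exists 0; constructor|].
  inversion HZ as [|b' l' Hb Hl]; subst.
  destruct (IH Z Hl) as [k Hk].
  rewrite Forall_forall in Hb.
  destruct (open_forall_in l (R b) (H b) Z Hb) as [k' Hk'].
  exists (k + k'); intros Y HY; constructor.
  - apply Forall_forall, Hk'; revert HY; apply agree_le; lia.
  - apply Hk; revert HY; apply agree_le; lia.
Qed.

Definition continuous (f : oracle -> oracle) : Prop :=
  forall k, exists k', forall Z Z', agree k' Z Z' -> agree k (f Z) (f Z').

Lemma open_preimage f phi : continuous f -> open phi -> open (fun Z => phi (f Z)).
Proof.
  intros Hf H Z HZ; destruct (H _ HZ) as [k Hk], (Hf k) as [k' Hk']; exists k'; auto.
Qed.

Lemma continuous_comp f g : continuous f -> continuous g -> continuous (fun Z => f (g Z)).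
Proof.
  intros Hf Hg k; destruct (Hf k) as [k' Hk'], (Hg k') as [k'' Hk'']; exists k''; auto.
Qed.

Lemma continuous_left : continuous left.
Proof. intros k; exists (k + k); intros Z Z' H i Hi; apply H; lia. Qed.

Lemma continuous_right : continuous right.
Proof. intros k; exists (k + k + 1); intros Z Z' H i Hi; apply H; lia. Qed.

Lemma continuous_join_r Z : continuous (fun X => join Z X).
Proof. intros k; exists k; intros; apply agree_join; auto using agree_refl. Qed.

Lemma open_at i : open (fun Z => Z i).
Proof. intros Z H; exists (S i); intros Z' HZ; apply HZ; auto. Qed.

Lemma open_not_at i : open (fun Z => ~ Z i).
Proof. intros Z H; exists (S i); intros Z' HZ H'; apply H, HZ; auto. Qed.

(** * Compactness of Cantor space *)

(** Bits of [Q] are chosen one at a time: [A n] holds the indices [k] for which [P k] follows the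
    first [n] choices, and bit [n] is true exactly if infinitely many of these have it true. Each
    [A n] thus stays infinite. *)
Lemma cluster_point (P : nat -> oracle) :
  exists Q, forall n K, exists k, K <= k /\ agree n (P k) Q.
Proof.
  set (often := fun A : oracle => forall K, exists k, K <= k /\ A k).
  set (A := fix A n : oracle := match n with
    | 0 => fun _ => True
    | S n => fun k => A n k /\ (P k n <-> often (fun k => A n k /\ P k n))
    end).
  assert (HA : forall n, often (A n)).
  { induction n as [|n IH]; [intros K; exists K; simpl; auto|].
    destruct (classic (often (fun k => A n k /\ P k n))) as [H|H].
    - intros K; destruct (H K) as [k [Hk [H1 H2]]]; exists k; simpl; tauto.
    - apply not_all_ex_not in H as HK; destruct HK as [K0 HK0].
      intros K; destruct (IH (K + K0)) as [k [Hk H1]]; exists k; split; [lia|].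
      simpl; split; [auto|]; split; intros H2; [|tauto].
      exfalso; apply HK0; exists k; split; [lia|auto]. }
  exists (fun n => often (fun k => A n k /\ P k n)).
  intros n K; destruct (HA n K) as [k [Hk H]]; exists k; split; auto.
  clear Hk; induction n as [|n IH]; intros i Hi; [lia|].
  destruct H as [H1 H2].
  destruct (Nat.eq_dec i n) as [->|Hn]; [exact H2|apply IH; auto; lia].
Qed.

(** Otherwise pick [P m] outside [R m] for every [m]. A cluster point [Q] lies in some [R m]; by
    openness so does [P j] for some [j >= m], and monotonicity puts [P j] into [R j]. *)
Lemma compactness (R : nat -> oracle -> Prop) :
  (forall m, open (R m)) -> (forall m m' P, m <= m' -> R m P -> R m' P) ->
  (forall P, exists m, R m P) -> exists m, forall P, R m P.
Proof.
  intros Ho Hm H; apply NNPP; intros Hn.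
  assert (HP : forall m, exists P, ~ R m P).
  { intros m; apply not_all_ex_not; intros H'; apply Hn; eauto. }
  destruct (functional_choice _ HP) as [P HP'].
  destruct (cluster_point P) as [Q HQ].
  destruct (H Q) as [m HR], (Ho m Q HR) as [k Hk].
  destruct (HQ k m) as [j [Hj Ha]].
  apply (HP' j), (Hm m); auto; apply Hk, agree_sym, Ha.
Qed.

(** A tube lemma: each [P] has a box around [(Z, P)] inside [phi], and compactness gives a single
    radius [k] for all [P]. *)
Lemma open_forall_oracle phi :
  open phi -> open (fun Z => forall P, phi (join Z P)).
Proof.
  intros H Z HZ.
  destruct (compactness (fun k P =>
    forall Z' P', agree k Z Z' -> agree k P P' -> phi (join Z' P'))) as [k Hk].
  - intros k P HP; exists k; intros P1 H1 Z' P' HZ' HP'; apply HP; auto.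
    intros i Hi; rewrite (H1 i Hi); auto.
  - intros k k' P Hk HP Z' P' HZ' HP'; apply HP; eapply agree_le; eauto.
  - intros P; destruct (H _ (HZ P)) as [k Hk]; exists k; intros Z' P' HZ' HP'.
    apply Hk, agree_join; auto.
  - exists k; intros Z' HZ' P; apply (Hk P); auto using agree_refl.
Qed.

(** * Operators with finite use *)

Definition lenv (l : list nat) : nat -> nat := fun i => nth i l 0.

(* The code of a pair used by [Rel]. *)
Definition pair_code (x y : nat) : nat := (x + y) * (x + y) + x.

Inductive code : Type :=
| cLt (s t : term)
| cIn (t : term)
| cNotIn (t : term)
| cAnd (a b : code)
| cOr (a b : code)
| cBall (t : term) (a : code)
| cEx (a : code)
| cComp (a : code) (ts : list term)
| cAll (a : code)
| cLeft (a : code)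
| cRight (a : code)
| cChain (t a : code) (F : list nat).

(* [W c] plays the role of the [c]-th enumeration operator: any countable
   family of operators with finite use that is closed under the constructors
   of [code] will do, so these operators need not be effective. [cChain] is the
   question asked when extending the finite part [F] of a condition inside its
   reservoir [X] by a chain [E] of the tournament [t] homogeneous for [P]: does
   this force [a] to converge below [m]? *)
Fixpoint W (c : code) (Z : oracle) (l : list nat) : Prop :=
  match c with
  | cLt s t => teval (lenv l) s < teval (lenv l) t
  | cIn t => Z (teval (lenv l) t)
  | cNotIn t => ~ Z (teval (lenv l) t)
  | cAnd a b => W a Z l /\ W b Z l
  | cOr a b => W a Z l \/ W b Z l
  | cBall t a => forall x, x < teval (lenv l) t -> W a Z (x :: l)
  | cEx a => exists x, W a Z (x :: l)
  | cComp a ts => W a Z (map (teval (lenv l)) ts)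
  | cAll a => forall P, W a (join Z P) l
  | cLeft a => W a (left Z) l
  | cRight a => W a (right Z) l
  | cChain t a F =>
      let D := left (left Z) in
      let X := right (left Z) in
      let P := right Z in
      let x := lenv l 0 in
      let m := lenv l 1 in
      exists E,
        (forall e, In e E -> e < m /\ X e) /\
        ForallOrdPairs (fun e e' => W t D [pair_code e e']) E /\
        ((forall e, In e E -> P e) \/ (forall e, In e E -> ~ P e)) /\
        forall G, (forall i, i < m -> (G i <-> In i (F ++ E))) ->
          exists u, u <= m /\ W a (join D G) [x; u]
  end.

Lemma W_open c : forall l, open (fun Z => W c Z l).
Proof.
  induction c as [s t|t|t|a IHa b IHb|a IHa b IHb|t a IHa|a IHa|a IHa ts|a IHa|a IHa|a IHa
                 |t IHt a IHa F]; intros l; cbn -[lenv].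
  - apply open_const.
  - apply open_at.
  - apply open_not_at.
  - apply open_and; auto.
  - apply open_or; auto.
  - apply open_forall_lt; auto.
  - apply open_ex; auto.
  - auto.
  - apply (open_forall_oracle (fun Q => W a Q l)); auto.
  - apply (open_preimage left (fun Q => W a Q l)); auto using continuous_left.
  - apply (open_preimage right (fun Q => W a Q l)); auto using continuous_right.
  - apply open_ex; intros E.
    repeat apply open_and.
    + apply (open_forall_in E (fun e Z => e < lenv l 1 /\ right (left Z) e)).
      intros e; apply open_and; [apply open_const|].
      apply (open_preimage (fun Z => right (left Z)) (fun Z => Z e));
        auto using continuous_comp, continuous_left, continuous_right, open_at.
    + apply (open_FOP (fun e e' Z => W t (left (left Z)) [pair_code e e'])).
      intros e e'; apply (open_preimage (fun Z => left (left Z))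
        (fun Z => W t Z [pair_code e e'])); auto using continuous_comp, continuous_left.
    + apply open_or.
      * apply (open_forall_in E (fun e Z => right Z e)); intros e.
        apply (open_preimage right (fun Z => Z e)); auto using continuous_right, open_at.
      * apply (open_forall_in E (fun e Z => ~ right Z e)); intros e.
        apply (open_preimage right (fun Z => ~ Z e)); auto using continuous_right, open_not_at.
    + apply (open_preimage (fun Z => left (left Z)) (fun D => forall G,
        (forall i, i < lenv l 1 -> (G i <-> In i (F ++ E))) ->
          exists u, u <= lenv l 1 /\ W a (join D G) [lenv l 0; u]));
        [auto using continuous_comp, continuous_left|].
      (* The implication is turned into a disjunction. Its hypothesis inspects only finitely many
         bits of [G], so its negation is open as well, and compactness handles the quantifier over
         [G]. *)
      assert (Ho : open (fun Q => ~ (forall i, i < lenv l 1 -> (right Q i <-> In i (F ++ E))) \/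
        exists u, u <= lenv l 1 /\ W a Q [lenv l 0; u])).
      { apply open_or.
        - apply (open_preimage right (fun G =>
            ~ (forall i, i < lenv l 1 -> (G i <-> In i (F ++ E)))));
            [apply continuous_right|].
          intros G HG; exists (lenv l 1); intros G' Ha H; apply HG; intros i Hi.
          rewrite (Ha i Hi); auto.
        - apply open_ex; intros u; apply open_and; [apply open_const|auto]. }
      apply open_forall_oracle in Ho.
      intros D HD; destruct (Ho D) as [k Hk].
      * intros G; rewrite right_join.
        destruct (classic (forall i, i < lenv l 1 -> (G i <-> In i (F ++ E)))); auto.
      * exists k; intros D' HD' G HG; destruct (Hk D' HD' G) as [H|H]; auto.
        rewrite right_join in H; tauto.
Qed.

(** * Enumeration of the operators and construction by stages *)

Lemma code_countable : exists f : code -> nat, forall a b, f a = f b -> a = b.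
Proof.
  pose (p := fun i j => to_nat (i, j)).
  assert (Hp : forall i j i' j', p i j = p i' j' -> i = i' /\ j = j').
  { intros i j i' j' H; apply to_nat_inj in H; inversion H; auto. }
  pose (ft := fix ft (t : term) : nat := match t with
    | Var n => p 0 n | Zero => p 1 0 | One => p 2 0
    | Add s t => p 3 (p (ft s) (ft t)) | Mul s t => p 4 (p (ft s) (ft t)) end).
  pose (fl := fun A (g : A -> nat) => fix fl (l : list A) : nat := match l with
    | [] => p 0 0 | a :: l => p 1 (p (g a) (fl l)) end).
  assert (Ht : forall s t, ft s = ft t -> s = t).
  { induction s; intros []; simpl; intros H; apply Hp in H as [H0 H]; try discriminate;
      try apply Hp in H as [? ?]; f_equal; auto. }
  assert (Hl : forall A (g : A -> nat), (forall a b, g a = g b -> a = b) ->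
    forall l l', fl A g l = fl A g l' -> l = l').
  { intros A g Hg; induction l; intros []; simpl; intros H; apply Hp in H as [H0 H];
      try discriminate; try apply Hp in H as [? ?]; f_equal; auto. }
  pose (f := fix f (c : code) : nat := match c with
    | cLt s t => p 0 (p (ft s) (ft t))
    | cIn t => p 1 (ft t)
    | cNotIn t => p 2 (ft t)
    | cAnd a b => p 3 (p (f a) (f b))
    | cOr a b => p 4 (p (f a) (f b))
    | cBall t a => p 5 (p (ft t) (f a))
    | cEx a => p 6 (f a)
    | cComp a ts => p 7 (p (f a) (fl term ft ts))
    | cAll a => p 8 (f a)
    | cLeft a => p 9 (f a)
    | cRight a => p 10 (f a)
    | cChain t a F => p 11 (p (f t) (p (f a) (fl nat (fun n => n) F)))
    end).
  pose proof (Hl term ft Ht) as Hlt; pose proof (Hl nat (fun n => n) (fun a b H => H)) as Hln.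
  exists f.
  induction a; intros []; simpl; intros H; apply Hp in H as [H0 H]; try discriminate;
    try apply Hp in H as [? H]; try apply Hp in H as [? ?]; f_equal; auto.
Qed.

Lemma code_enumeration : exists d : nat -> code, forall c, exists n, d n = c.
Proof.
  destruct code_countable as [f Hf].
  destruct (functional_choice (fun n c => (exists c', f c' = n) -> f c = n)) as [d Hd].
  - intros n; destruct (classic (exists c', f c' = n)) as [[c Hc]|H];
      [exists c; auto|exists (cLt Zero Zero); tauto].
  - exists d; intros c; exists (f c); apply Hf, Hd; eauto.
Qed.

(** The relation also sees the stage [n], so that a construction can treat the [n]-th requirement at
    stage [n] while keeping the invariant [P]. *)
Lemma dependent_choice {A} (P : A -> Prop) (R : nat -> A -> A -> Prop) (a0 : A) :
  P a0 -> (forall n a, P a -> exists a', P a' /\ R n a a') ->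
  exists f, f 0 = a0 /\ forall n, P (f n) /\ R n (f n) (f (S n)).
Proof.
  intros H0 HS.
  destruct (functional_choice (fun (na : nat * A) a' =>
    P (snd na) -> P a' /\ R (fst na) (snd na) a'))
    as [g Hg].
  - intros [n a]; simpl; destruct (classic (P a)) as [H|H].
    + destruct (HS n a H) as [a' Ha']; eauto.
    + exists a; tauto.
  - set (f := fix f n := match n with 0 => a0 | S n => g (n, f n) end).
    assert (Hf : forall n, P (f n)).
    { induction n as [|n IH]; simpl; auto; apply (Hg (n, f n)); auto. }
    exists f; split; [reflexivity|]; intros n; split; [auto|].
    apply (Hg (n, f n)); simpl; auto.
Qed.

(** * Hyperimmunity *)

(** Here [c] is read as a possibly multivalued function from [x] to bounds [u]. It fails to show
    that [B] meets every block [(x, u]]: it diverges somewhere, or one of its blocks avoids [B]. *)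
Definition misses (B Z : oracle) (c : code) : Prop :=
  (exists x, forall u, ~ W c Z [x; u]) \/
  (exists x u, W c Z [x; u] /\ forall y, x < y <= u -> ~ B y).

(* Both sets have to stay hyperimmune: one will be the [omega] part and the
   other the [omega^*] part of a stable linear order. *)
Definition hyperimmune (B : bool -> oracle) (Z : oracle) : Prop :=
  forall i c, misses (B i) Z c.

Fixpoint num (n : nat) : term :=
  match n with 0 => Zero | S n => Add (num n) One end.

Lemma teval_num e n : teval e (num n) = n.
Proof. induction n; simpl; lia. Qed.

Lemma requirement_enumeration :
  exists d : nat -> bool * code, forall i c, exists n, d n = (i, c).
Proof.
  destruct code_enumeration as [d Hd].
  exists (fun n => (Nat.even n, d (Nat.div2 n))); intros i c.
  destruct (Hd c) as [n <-]; exists (if i then 2 * n else S (2 * n)).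
  destruct i.
  - rewrite Nat.even_even, Nat.div2_double; reflexivity.
  - rewrite Nat.even_succ, Nat.odd_even, Nat.div2_succ_double; reflexivity.
Qed.

(* A nonempty class that is co-enumerable in [Z] either contains a nonempty
   subclass on which [c] diverges at some [x], or bounds for the values of [c]
   at every [x] on the whole class can be found from [Z] by compactness. *)
Lemma basis_step B Z v i c :
  hyperimmune B Z -> (exists P, ~ W v (join Z P) []) ->
  exists v', (exists P, ~ W v' (join Z P) []) /\
    (forall P, W v (join Z P) [] -> W v' (join Z P) []) /\
    (forall P, ~ W v' (join Z P) [] -> misses (B i) (join Z P) c).
Proof.
  intros HB HP.
  (* Operators such as [v] enumerate the complement of a class of sets [P]; [v2 x] also removes from
     the class every [P] for which [c] converges at [x]. *)
  pose (v2 := fun x => cOr (cComp v []) (cEx (cComp c [num x; Var 0]))).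
  assert (Hv2 : forall x Q, W (v2 x) Q [] <-> W v Q [] \/ exists u, W c Q [x; u]).
  { intros x Q; cbn; setoid_rewrite teval_num; tauto. }
  destruct (classic (exists x P, ~ W (v2 x) (join Z P) [])) as [[x Hx]|Hn].
  - exists (v2 x); split; [exact Hx|]; split; intros P H.
    + apply Hv2; auto.
    + rewrite Hv2 in H; left; exists x; intros u Hu; apply H; eauto.
  - exists v; split; [exact HP|]; split; [auto|]; intros P HnP.
    (* [w] accepts [u] at [x] if every [P] in the class has a value of [c] at [x] that is at most
       [u]. In this case compactness makes [w] converge everywhere, so one of its blocks avoids
       [B i]. *)
    pose (w := cAll (cOr (cComp v [])
      (cEx (cAnd (cLt (Var 0) (Add (Var 2) One)) (cComp c [Var 1; Var 0]))))).
    assert (Hw : forall x u, W w Z [x; u] <-> forall P, W v (join Z P) [] \/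
      exists u', u' < u + 1 /\ W c (join Z P) [x; u']) by (intros; cbn; tauto).
    destruct (HB i w) as [[x Hx]|[x [u [Hu Hy]]]].
    + exfalso.
      destruct (compactness (fun u P => W v (join Z P) [] \/
        exists u', u' < u + 1 /\ W c (join Z P) [x; u'])) as [u Hu].
      * intros u; apply (open_preimage (fun P => join Z P) (fun Q => W v Q [] \/
          exists u', u' < u + 1 /\ W c Q [x; u'])); [apply continuous_join_r|].
        apply open_or; [apply W_open|]; apply open_ex; intros u'.
        apply open_and; [apply open_const|apply W_open].
      * intros u u' Q Hle [H|[u2 [Hu2 H]]]; [auto|right; exists u2; split; [lia|auto]].
      * intros Q; apply NNPP; intros H; apply Hn; exists x, Q; rewrite Hv2.
        intros [H1|[u H1]]; apply H; [exists 0; auto|].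
        exists u; right; exists u; split; [lia|auto].
      * apply (Hx u), Hw, Hu.
    + right; rewrite Hw in Hu; destruct (Hu P) as [H|[u' [Hu' H]]]; [contradiction|].
      exists x, u'; split; [auto|]; intros y Hxy; apply Hy; lia.
Qed.

(** The closed class given by [v] is shrunk once for each requirement, and compactness supplies a
    point in the intersection of the decreasing nonempty classes. *)
Lemma basis B Z v :
  hyperimmune B Z -> (exists P, ~ W v (join Z P) []) ->
  exists P, ~ W v (join Z P) [] /\ hyperimmune B (join Z P).
Proof.
  intros HB HP; destruct requirement_enumeration as [d Hd].
  destruct (dependent_choice (fun v => exists P, ~ W v (join Z P) [])
    (fun n v v' => (forall P, W v (join Z P) [] -> W v' (join Z P) []) /\
      (forall P, ~ W v' (join Z P) [] -> misses (B (fst (d n))) (join Z P) (snd (d n)))) v)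
    as [f [Hf0 Hf]]; [auto| |].
  { intros n w Hw; destruct (basis_step B Z w (fst (d n)) (snd (d n)) HB Hw) as [v' [H1 H2]].
    eauto. }
  assert (H : exists P, forall n, ~ W (f n) (join Z P) []).
  { apply NNPP; intros Hn.
    destruct (compactness (fun n P => W (f n) (join Z P) [])) as [n Hall].
    - intros n; apply (open_preimage (fun P => join Z P) (fun Q => W (f n) Q []));
        [apply continuous_join_r|apply W_open].
    - intros m m' P Hle; induction Hle; auto; intros H; apply (Hf m0); auto.
    - intros P; apply NNPP; intros H; apply Hn; exists P; intros n Hw; apply H; eauto.
    - destruct (Hf n) as [[P HnP] _]; auto. }
  destruct H as [P H]; exists P; split.
  - rewrite <- Hf0; apply H.
  - intros i c; destruct (Hd i c) as [n Hn].
    destruct (Hf n) as [_ [_ Hm]]; specialize (Hm P (H (S n))).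
    rewrite Hn in Hm; exact Hm.
Qed.

(** * Decidable relations *)

(** Decidability in the form of Post's theorem: [a] enumerates the relation and [b] its
    complement. *)
Definition decidable_in (Z : oracle) (S : list nat -> Prop) : Prop :=
  exists a b, forall l, (S l <-> W a Z l) /\ (~ S l <-> W b Z l).

Definition reducible (X Z : oracle) : Prop := decidable_in Z (fun l => X (lenv l 0)).

Lemma decidable_ext Z S S' :
  (forall l, S l <-> S' l) -> decidable_in Z S -> decidable_in Z S'.
Proof. intros H [a [b Hab]]; exists a, b; intros l; rewrite <- H; auto. Qed.

Lemma decidable_not Z S : decidable_in Z S -> decidable_in Z (fun l => ~ S l).
Proof.
  intros [a [b H]]; exists b, a; intros l; destruct (H l) as [<- <-]; split; [tauto|].
  split; [apply NNPP|tauto].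
Qed.

Lemma decidable_and Z S S' :
  decidable_in Z S -> decidable_in Z S' -> decidable_in Z (fun l => S l /\ S' l).
Proof.
  intros [a [b H]] [a' [b' H']]; exists (cAnd a a'), (cOr b b'); intros l.
  destruct (H l) as [H1 H2], (H' l) as [H3 H4]; cbn; rewrite <- H1, <- H2, <- H3, <- H4.
  split; [tauto|]; split; [apply not_and_or|tauto].
Qed.

Lemma decidable_or Z S S' :
  decidable_in Z S -> decidable_in Z S' -> decidable_in Z (fun l => S l \/ S' l).
Proof.
  intros H H'; apply (decidable_ext Z (fun l => ~ (~ S l /\ ~ S' l))).
  - intros l; destruct (classic (S l)), (classic (S' l)); tauto.
  - apply decidable_not, decidable_and; apply decidable_not; auto.
Qed.

Lemma decidable_imp Z S S' :
  decidable_in Z S -> decidable_in Z S' -> decidable_in Z (fun l => S l -> S' l).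
Proof.
  intros H H'; apply (decidable_ext Z (fun l => ~ S l \/ S' l)).
  - intros l; split; [tauto|]; intros K; destruct (classic (S l)); auto.
  - auto using decidable_or, decidable_not.
Qed.

Lemma decidable_ball Z t S :
  decidable_in Z S ->
  decidable_in Z (fun l => forall x, x < teval (lenv l) t -> S (x :: l)).
Proof.
  intros [a [b H]]; exists (cBall t a), (cEx (cAnd (cLt (Var 0) (tshift t)) b)); intros l.
  assert (Ht : forall x, teval (lenv (x :: l)) (tshift t) = teval (lenv l) t).
  { intros x; unfold tshift; rewrite teval_tsubst; reflexivity. }
  cbn -[lenv]; split.
  - split; intros K x Hx; apply (proj1 (H _)), (K x Hx).
  - split.
    + intros K; apply not_all_ex_not in K as [x Kx]; exists x.
      rewrite Ht, <- (proj2 (H (x :: l))); apply imply_to_and in Kx; exact Kx.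
    + intros [x Kx] K; rewrite Ht, <- (proj2 (H (x :: l))) in Kx.
      apply Kx, K, Kx.
Qed.

Lemma decidable_bex Z t S :
  decidable_in Z S ->
  decidable_in Z (fun l => exists x, x < teval (lenv l) t /\ S (x :: l)).
Proof.
  intros H; apply (decidable_ext Z (fun l => ~ forall x, x < teval (lenv l) t -> ~ S (x :: l))).
  - intros l; split.
    + intros K; apply not_all_ex_not in K as [x Kx]; exists x.
      apply imply_to_and in Kx; split; [tauto|apply NNPP; tauto].
    + intros [x [Hx HS]] K; eapply K; eauto.
  - apply decidable_not.
    apply (decidable_ball Z t (fun l => ~ S l)), decidable_not, H.
Qed.

Lemma decidable_lt Z s t : decidable_in Z (fun l => teval (lenv l) s < teval (lenv l) t).
Proof. exists (cLt s t), (cLt t (Add s One)); intros l; cbn -[lenv]; lia. Qed.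

Lemma decidable_eq Z s t : decidable_in Z (fun l => teval (lenv l) s = teval (lenv l) t).
Proof.
  apply (decidable_ext Z (fun l => ~ teval (lenv l) s < teval (lenv l) t /\
    ~ teval (lenv l) t < teval (lenv l) s)); [intros l; lia|].
  apply decidable_and; apply decidable_not, decidable_lt.
Qed.

Lemma decidable_in_term Z t : decidable_in Z (fun l => Z (teval (lenv l) t)).
Proof. exists (cIn t), (cNotIn t); intros l; cbn; tauto. Qed.

Lemma decidable_comp Z S ts :
  decidable_in Z S -> decidable_in Z (fun l => S (map (teval (lenv l)) ts)).
Proof. intros [a [b H]]; exists (cComp a ts), (cComp b ts); intros l; apply H. Qed.

Lemma reducible_term X Z t :
  reducible X Z -> decidable_in Z (fun l => X (teval (lenv l) t)).
Proof. intros H; exact (decidable_comp Z _ [t] H). Qed.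

Lemma decidable_join Z X S : decidable_in Z S -> decidable_in (join Z X) S.
Proof.
  intros [a [b H]]; exists (cLeft a), (cLeft b); intros l; cbn; rewrite left_join; apply H.
Qed.

Lemma reducible_refl Z : reducible Z Z.
Proof. apply (decidable_in_term Z (Var 0)). Qed.

Lemma reducible_join_r Z X : reducible X (join Z X).
Proof.
  exists (cRight (cIn (Var 0))), (cRight (cNotIn (Var 0))); intros l; cbn -[lenv].
  rewrite right_join; tauto.
Qed.

Lemma reducible_join X Y Z : reducible X Z -> reducible Y Z -> reducible (join X Y) Z.
Proof.
  intros HX HY.
  apply (decidable_ext Z (fun l => exists n, n < lenv l 0 + 1 /\
    ((lenv l 0 = n + n /\ X n) \/ (lenv l 0 = n + n + 1 /\ Y n)))).
  - intros l; generalize (lenv l 0); clear l; intros i.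
    assert (HX' : forall n, join X Y (n + n) <-> X n).
    { intros n; change (left (join X Y) n <-> X n); rewrite left_join; tauto. }
    assert (HY' : forall n, join X Y (n + n + 1) <-> Y n).
    { intros n; change (right (join X Y) n <-> Y n); rewrite right_join; tauto. }
    split.
    + intros [n [_ [[-> H]|[-> H]]]]; [apply HX'|apply HY']; auto.
    + intros H; destruct (Nat.Even_or_Odd i) as [[n Hn]|[n Hn]]; exists n; split; try lia.
      * left; split; [lia|]; apply HX'; replace (n + n) with i by lia; auto.
      * right; split; [lia|]; apply HY'; replace (n + n + 1) with i by lia; auto.
  - refine (decidable_bex Z (Add (Var 0) One) (fun l =>
      (lenv l 1 = lenv l 0 + lenv l 0 /\ X (lenv l 0)) \/
      (lenv l 1 = lenv l 0 + lenv l 0 + 1 /\ Y (lenv l 0))) _).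
    apply decidable_or; apply decidable_and; auto.
    + exact (decidable_eq Z (Var 1) (Add (Var 0) (Var 0))).
    + exact (decidable_eq Z (Var 1) (Add (Add (Var 0) (Var 0)) One)).
Qed.

(* The singleton of a set reducible to [Z] is co-enumerable in [Z]. *)
Lemma hyperimmune_reducible B X Z : hyperimmune B Z -> reducible X Z -> hyperimmune B X.
Proof.
  intros HB [a [b H]].
  assert (HX : forall n, (X n <-> W a Z [n]) /\ (~ X n <-> W b Z [n])) by (intros; apply (H [n])).
  (* Bit [n] of [P] is stored at position [2n + 1] of [join Z P]; [v] searches for a place where [P]
     and [X] differ. *)
  pose (t := Add (Add (Var 0) (Var 0)) One).
  pose (v := cEx (cOr (cAnd (cIn t) (cLeft (cComp b [Var 0])))
                      (cAnd (cNotIn t) (cLeft (cComp a [Var 0]))))).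
  assert (Hv : forall P, W v (join Z P) [] <-> exists n, (P n /\ ~ X n) \/ (~ P n /\ X n)).
  { assert (E : forall P, W v (join Z P) [] <->
      exists n, (right (join Z P) n /\ W b (left (join Z P)) [n]) \/
                (~ right (join Z P) n /\ W a (left (join Z P)) [n])) by (intros; cbn; tauto).
    intros P; rewrite E; rewrite left_join, right_join.
    split; intros [n Hn]; exists n; destruct (HX n) as [H1 H2]; tauto. }
  destruct (basis B Z v HB) as [P [HP HJ]].
  - exists X; rewrite Hv; intros [n Hn]; tauto.
  - assert (P = X) as ->.
    { apply oracle_ext; intros n; apply NNPP; intros Hn; apply HP, Hv; exists n; tauto. }
    intros i c; specialize (HJ i (cRight c)); unfold misses in *; cbn in HJ.
    rewrite right_join in HJ; exact HJ.
Qed.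

(** * Transitive subtournaments *)

Definition rel (T : oracle) (x y : nat) : Prop := T (pair_code x y).

Definition tournament_rel (T : oracle) : Prop :=
  (forall x, ~ rel T x x) /\
  (forall x y, x <> y -> (rel T x y \/ rel T y x) /\ ~ (rel T x y /\ rel T y x)).

Definition unbounded (X : oracle) : Prop := forall n, exists x, n < x /\ X x.

Lemma unbounded_split (X Y Y' : oracle) k :
  unbounded X -> (forall x, X x -> k < x -> Y x \/ Y' x) -> unbounded Y \/ unbounded Y'.
Proof.
  intros HX H; apply NNPP; intros Hn; apply not_or_and in Hn as [H1 H2].
  apply not_all_ex_not in H1 as [n Hn], H2 as [n' Hn'].
  destruct (HX (k + n + n')) as [x [Hx HXx]].
  destruct (H x HXx) as [Hy|Hy]; [lia| |];
    [apply Hn|apply Hn']; exists x; split; auto; lia.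
Qed.

Lemma FOP_app {A} (R : A -> A -> Prop) l l' :
  ForallOrdPairs R (l ++ l') <->
  ForallOrdPairs R l /\ ForallOrdPairs R l' /\ forall a b, In a l -> In b l' -> R a b.
Proof.
  induction l as [|c l IH]; simpl.
  - split; [intros H; repeat split; auto; [constructor|tauto]|tauto].
  - split.
    + intros H; inversion H as [|c' l0 Hc Hl]; subst; apply IH in Hl as [H1 [H2 H3]].
      rewrite Forall_app in Hc; destruct Hc as [Hc Hc'].
      repeat split; auto; [constructor; auto|].
      rewrite Forall_forall in Hc'; intros a b [<-|Ha] Hb; auto.
    + intros [H [H' H'']]; inversion H as [|c' l0 Hc Hl]; subst; constructor.
      * apply Forall_app; split; [auto|]; apply Forall_forall; auto.
      * apply IH; auto.
Qed.

Lemma FOP_filter {A} (R : A -> A -> Prop) f l :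
  ForallOrdPairs R l -> ForallOrdPairs R (filter f l).
Proof.
  induction 1 as [|a l Ha Hl IH]; simpl; [constructor|].
  destruct (f a); auto; constructor; auto.
  rewrite Forall_forall in *; intros x Hx; apply filter_In in Hx; apply Ha; tauto.
Qed.

(** A pair related against the order of the list would contradict antisymmetry, so on the list
    [rel T] agrees with the list order. *)
Lemma chain_transitive T l : tournament_rel T -> ForallOrdPairs (rel T) l ->
  forall x y z, In x l -> In y l -> In z l -> rel T x y -> rel T y z -> rel T x z.
Proof.
  intros [Hirr Htot] Hl.
  assert (Hanti : forall x y, rel T x y -> rel T y x -> False).
  { intros x y H H'; destruct (Nat.eq_dec x y) as [->|E]; [eapply Hirr; eauto|].
    apply (proj2 (Htot x y E)); auto. }
  induction Hl as [|a l Ha Hl IH]; simpl; [tauto|].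
  rewrite Forall_forall in Ha.
  intros x y z [<-|Hx] [<-|Hy] [<-|Hz] Hxy Hyz; eauto; exfalso; eauto.
Qed.

Lemma hyperimmune_subset B Z X Y :
  hyperimmune B (join Z X) -> reducible Y (join Z X) -> hyperimmune B (join Z Y).
Proof.
  intros HB HY; apply (hyperimmune_reducible B _ (join Z X)); auto.
  apply reducible_join; auto; apply decidable_join, reducible_refl.
Qed.

(** The vertices below [m] are treated one at a time: the reservoir splits into the numbers beaten
    by the vertex and those beating it. Both parts are decidable from [Z] and the reservoir, and an
    infinite one is kept. *)
Lemma thin B Z T X m :
  tournament_rel T -> reducible T Z -> unbounded X -> hyperimmune B (join Z X) ->
  exists Y, (forall y, Y y -> X y /\ m <= y) /\ unbounded Y /\ hyperimmune B (join Z Y) /\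
    forall e, e < m -> (forall y, Y y -> rel T e y) \/ (forall y, Y y -> rel T y e).
Proof.
  intros [Hirr Htot] HT HX HB; induction m as [|m [Y [HYX [HY [HBY Hlim]]]]].
  { exists X; repeat split; auto; intros; lia. }
  assert (Hred : forall R : nat -> Prop,
    decidable_in (join Z Y) (fun l => R (lenv l 0)) ->
    hyperimmune B (join Z (fun y => Y y /\ m < y /\ R y))).
  { intros R HR; apply (hyperimmune_subset B Z Y); auto.
    apply (decidable_ext _ (fun l => Y (lenv l 0) /\
      (teval (lenv l) (num m) < teval (lenv l) (Var 0) /\ R (lenv l 0)))).
    - intros l; rewrite teval_num; simpl; tauto.
    - apply decidable_and; [apply reducible_join_r|].
      apply decidable_and; [apply decidable_lt|auto]. }
  assert (H1 : decidable_in (join Z Y) (fun l => rel T m (lenv l 0))).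
  { apply decidable_join; pose (s := Add (num m) (Var 0)).
    refine (decidable_ext _ _ _ _ (reducible_term T Z (Add (Mul s s) (num m)) HT)).
    intros l; cbn -[lenv]; rewrite teval_num; tauto. }
  assert (H2 : decidable_in (join Z Y) (fun l => rel T (lenv l 0) m)).
  { apply decidable_join; pose (s := Add (Var 0) (num m)).
    refine (decidable_ext _ _ _ _ (reducible_term T Z (Add (Mul s s) (Var 0)) HT)).
    intros l; cbn -[lenv]; rewrite teval_num; tauto. }
  destruct (unbounded_split Y (fun y => Y y /\ m < y /\ rel T m y)
    (fun y => Y y /\ m < y /\ rel T y m) m HY) as [HU|HU].
  { intros x Hx Hm; destruct (proj1 (Htot m x ltac:(lia))); auto. }
  - exists (fun y => Y y /\ m < y /\ rel T m y); split; [|split; [auto|split; [auto|]]].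
    + intros y [Hy Hm]; split; [apply HYX; auto|lia].
    + intros e He; destruct (Nat.eq_dec e m) as [->|Hne]; [left; tauto|].
      destruct (Hlim e ltac:(lia)); [left|right]; intros y [Hy _]; auto.
  - exists (fun y => Y y /\ m < y /\ rel T y m); split; [|split; [auto|split; [auto|]]].
    + intros y [Hy Hm]; split; [apply HYX; auto|lia].
    + intros e He; destruct (Nat.eq_dec e m) as [->|Hne]; [right; tauto|].
      destruct (Hlim e ltac:(lia)); [left|right]; intros y [Hy _]; auto.
Qed.

(* The reservoir lies in a minimal interval of the finite chain
   [lower ++ upper]: above [lower] and below [upper]. *)
Record condition := Condition { lower : list nat; upper : list nat; reservoir : oracle }.

Definition chain (c : condition) : list nat := lower c ++ upper c.

Definition valid (B : bool -> oracle) (Z T : oracle) (c : condition) : Prop :=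
  ForallOrdPairs (rel T) (chain c) /\ unbounded (reservoir c) /\
  (forall x a, reservoir c x -> In a (lower c) -> rel T a x) /\
  (forall x b, reservoir c x -> In b (upper c) -> rel T x b) /\
  hyperimmune B (join Z (reservoir c)).

Definition extends (c c' : condition) : Prop :=
  (forall x, reservoir c' x -> reservoir c x) /\
  (forall i, In i (chain c) -> In i (chain c')) /\
  (forall i, In i (chain c') -> In i (chain c) \/ reservoir c i).

(** Phrased through initial segments because a halting computation inspects only one of them. *)
Definition compatible (T : oracle) (c : condition) (G : oracle) : Prop :=
  forall m, exists E,
    (forall e, In e E -> e < m /\ reservoir c e) /\
    ForallOrdPairs (rel T) E /\
    forall i, i < m -> (G i <-> In i (chain c ++ E)).

Lemma extends_refl c : extends c c.
Proof. repeat split; auto. Qed.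

Lemma extends_trans c c' c'' : extends c c' -> extends c' c'' -> extends c c''.
Proof.
  intros [H1 [H2 H3]] [H4 [H5 H6]]; repeat split; auto.
  intros i Hi; destruct (H6 i Hi); auto.
Qed.

(** Coming from the reservoir, [E] fits between [lower] and [upper]. It is appended to [lower] if it
    precedes all of [Y] and put in front of [upper] if it follows all of [Y], so [Y] again lies in
    one interval. *)
Lemma absorb B Z T c E Y :
  valid B Z T c ->
  (forall e, In e E -> reservoir c e) -> ForallOrdPairs (rel T) E ->
  (forall y, Y y -> reservoir c y) -> unbounded Y -> hyperimmune B (join Z Y) ->
  (forall e y, In e E -> Y y -> rel T e y) \/ (forall e y, In e E -> Y y -> rel T y e) ->
  exists c', valid B Z T c' /\ extends c c' /\ reservoir c' = Y /\
    forall i, In i (chain c') <-> In i (chain c ++ E).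
Proof.
  destruct c as [l u X]; unfold valid, extends, chain; simpl.
  intros [HF [HX [Hl [Hu HB]]]] HE HEc HY HYu HYB Hlim.
  apply FOP_app in HF as [HFl [HFu HFlu]].
  assert (HF : ForallOrdPairs (rel T) (l ++ E ++ u)).
  { rewrite !FOP_app; repeat split; auto.
    intros a b Ha Hb; apply in_app_or in Hb as [Hb|Hb]; auto. }
  destruct Hlim as [Hlim|Hlim];
    [exists (Condition (l ++ E) u Y)|exists (Condition l (E ++ u) Y)]; simpl;
    rewrite <- ?app_assoc; repeat split; auto;
    try (intros *; rewrite !in_app_iff; intuition; fail);
    intros x a Hx Ha; apply in_app_or in Ha as [Ha|Ha]; auto.
Qed.

Lemma force_requirement B Z T c i a :
  tournament_rel T -> reducible T Z -> valid B Z T c ->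
  exists c', valid B Z T c' /\ extends c c' /\
    forall G, compatible T c' G -> misses (B i) (join Z G) a.
Proof.
  intros HTt HT Hc; pose proof Hc as [HF [HX [Hl [Hu HB]]]].
  pose proof HT as [t [t' Ht0]].
  assert (Ht : (fun e e' => W t Z [pair_code e e']) = rel T).
  { apply functional_extensionality; intros e; apply functional_extensionality; intros e'.
    apply propositional_extensionality; symmetry; apply (Ht0 [pair_code e e']). }
  set (X := reservoir c) in *.
  set (forces := fun x m P => exists E,
    (forall e, In e E -> e < m /\ X e) /\ ForallOrdPairs (rel T) E /\
    ((forall e, In e E -> P e) \/ (forall e, In e E -> ~ P e)) /\
    forall G, (forall i, i < m -> (G i <-> In i (chain c ++ E))) ->
      exists u, u <= m /\ W a (join Z G) [x; u]).
  set (q := cChain t a (chain c)).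
  assert (Hq : forall P x m, W q (join (join Z X) P) [x; m] <-> forces x m P).
  { intros P x m; unfold q; cbn -[lenv]; rewrite !left_join, !right_join.
    unfold forces; rewrite <- Ht; reflexivity. }
  (* [cAll q] accepts [m] at [x] if every partition has a forcing chain below [m]. Hyperimmunity
     relative to [join Z X] makes it diverge at some [x] or yields a block [(x, m]] that avoids
     [B i]. *)
  destruct (HB i (cAll q)) as [[x Hx]|[x [m [Hm Hmiss]]]].
  - assert (HP : exists P, forall m, ~ forces x m P).
    { apply NNPP; intros Hn.
      destruct (compactness (fun m P => W q (join (join Z X) P) [x; m])) as [m Hm].
      - intros m; apply (open_preimage (fun P => join (join Z X) P) (fun Q => W q Q [x; m]));
          [apply continuous_join_r|apply W_open].
      - intros m m' P Hle; rewrite !Hq; intros [E [H1 [H2 [H3 H4]]]].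
        exists E; split; [intros e He; destruct (H1 e He); split; [lia|auto]|].
        split; [auto|]; split; [auto|]; intros G HG.
        destruct (H4 G) as [u [Hle' HW]]; [intros j Hj; apply HG; lia|].
        exists u; split; [lia|auto].
      - intros P; apply NNPP; intros H; apply Hn; exists P; intros m Hf; apply H.
        exists m; apply Hq, Hf.
      - exact (Hx m Hm). }
    (* The class passed to [basis] consists of the partitions without a forcing chain at [x]. *)
    pose (v := cEx (cComp q [num x; Var 0])).
    assert (Hv : forall P, W v (join (join Z X) P) [] <-> exists m, forces x m P).
    { intros P; setoid_rewrite <- Hq; cbn -[q]; setoid_rewrite teval_num; tauto. }
    destruct (basis B (join Z X) v HB) as [P [HnP HBP]].
    { destruct HP as [P HP]; exists P; rewrite Hv; intros [m Hm]; exact (HP m Hm). }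
    rewrite Hv in HnP.
    assert (Hred : forall R : nat -> Prop,
      decidable_in (join (join Z X) P) (fun l => R (lenv l 0)) ->
      hyperimmune B (join Z (fun y => X y /\ R y))).
    { intros R HR; apply (hyperimmune_reducible B _ _ HBP), reducible_join.
      - apply decidable_join, decidable_join, reducible_refl.
      - apply decidable_and; [apply decidable_join, reducible_join_r|exact HR]. }
    assert (HY : exists Y, (forall y, Y y -> X y) /\ unbounded Y /\
      hyperimmune B (join Z Y) /\ ((forall y, Y y -> P y) \/ (forall y, Y y -> ~ P y))).
    { destruct (unbounded_split X (fun y => X y /\ P y) (fun y => X y /\ ~ P y) 0 HX)
        as [HU|HU].
      - intros y Hy _; destruct (classic (P y)); auto.
      - exists (fun y => X y /\ P y); split; [tauto|split; [auto|split; [|left; tauto]]].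
        apply Hred, reducible_join_r.
      - exists (fun y => X y /\ ~ P y); split; [tauto|split; [auto|split; [|right; tauto]]].
        apply (Hred (fun y => ~ P y)).
        apply (decidable_not _ (fun l => P (lenv l 0))), reducible_join_r. }
    destruct HY as [Y [HYX [HYu [HYB HYP]]]].
    exists (Condition (lower c) (upper c) Y); split; [|split].
    + unfold valid, chain; simpl; repeat split; auto.
    + repeat split; simpl; auto.
    (* If the computation halted, the elements of [G] taken from [Y] below [k + u] would form a
       forcing chain: they are homogeneous for [P], and [k + u] covers both the use and the
       value. *)
    + intros G HG; left; exists x; intros u HW; apply HnP.
      destruct (W_open a [x; u] _ HW) as [k Hk]; exists (k + u).
      destruct (HG (k + u)) as [E [H1 [H2 H3]]]; exists E; split; [|split; [auto|split]].
      * intros e He; destruct (H1 e He); auto.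
      * destruct HYP as [HYP|HYP]; [left|right]; intros e He; apply HYP, H1; auto.
      * intros G' HG'; exists u; split; [lia|]; apply Hk, agree_join; [apply agree_refl|].
        intros j Hj; rewrite HG', H3 by lia; tauto.
  - destruct (thin B Z T X m HTt HT HX HB) as [Y [HYX [HYu [HYB Hlim]]]].
    (* The partition chosen is that by behaviour towards [Y]. By [thin], numbers below [m] outside
       this [P] follow all of [Y], so either kind of homogeneous chain can be absorbed. *)
    destruct (proj1 (Hq (fun e => forall y, Y y -> rel T e y) x m)
      (Hm (fun e => forall y, Y y -> rel T e y))) as [E [H1 [H2 [H3 H4]]]].
    destruct (absorb B Z T c E Y) as [c' [Hc' [Hext [HcY Hch]]]]; auto.
    { intros e He; apply H1; auto. }
    { intros y Hy; apply HYX; auto. }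
    { destruct H3 as [H3|H3]; [left; auto|right; intros e y He Hy].
      destruct (Hlim e (proj1 (H1 e He))) as [K|K]; [|auto]; exfalso; apply (H3 e He), K. }
    exists c'; split; [auto|]; split; [auto|]; intros G HG; right.
    destruct (H4 G) as [u [Hum HW]].
    + destruct (HG m) as [E' [HE' [_ HG']]]; intros j Hj; rewrite HG' by auto.
      (* The new reservoir starts at [m] or later, so nothing more enters [G] below [m]. *)
      assert (E' = []) as ->.
      { destruct E' as [|e E']; auto; destruct (HE' e (or_introl eq_refl)) as [He He'].
        rewrite HcY in He'; apply HYX in He'; lia. }
      rewrite app_nil_r; apply Hch.
    + exists x, u; split; [auto|]; intros y Hxy; apply Hmiss; lia.
Qed.

Lemma force_element B Z T c n :
  tournament_rel T -> reducible T Z -> valid B Z T c ->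
  exists c', valid B Z T c' /\ extends c c' /\ exists e, n < e /\ In e (chain c').
Proof.
  intros HTt HT Hc; pose proof Hc as [HF [HX [Hl [Hu HB]]]].
  destruct (HX n) as [e [Hne He]].
  destruct (thin B Z T _ (S e) HTt HT HX HB) as [Y [HYX [HYu [HYB Hlim]]]].
  destruct (absorb B Z T c [e] Y) as [c' [Hc' [Hext [_ Hch]]]]; auto.
  - intros e' [<-|[]]; auto.
  - repeat constructor.
  - intros y Hy; apply HYX; auto.
  - destruct (Hlim e ltac:(lia)); [left|right]; intros e' y [<-|[]]; auto.
  - exists c'; split; [auto|split; [auto|]]; exists e; split; [auto|].
    apply Hch, in_or_app; right; left; reflexivity.
Qed.

Lemma EM_preserves_hyperimmune B Z T :
  hyperimmune B Z -> reducible T Z -> tournament_rel T ->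
  exists G, unbounded G /\
    (forall x y z, G x -> G y -> G z -> rel T x y -> rel T y z -> rel T x z) /\
    hyperimmune B (join Z G).
Proof.
  intros HB HT HTt; destruct requirement_enumeration as [d Hd].
  destruct (dependent_choice (valid B Z T) (fun n c c' => extends c c' /\
      (exists e, n < e /\ In e (chain c')) /\
      forall G, compatible T c' G -> misses (B (fst (d n))) (join Z G) (snd (d n)))
    (Condition [] [] (fun _ => True))) as [c [_ Hc]].
  { repeat split; simpl; try tauto.
    - constructor.
    - intros n; exists (S n); auto.
    - apply (hyperimmune_reducible B _ Z HB), reducible_join; [apply reducible_refl|].
      exists (cLt Zero One), (cLt One Zero); intros l; cbn; intuition lia. }
  { intros n c Hc.
    destruct (force_element B Z T c n) as [c1 [H1 [H2 [e [Hne He]]]]]; auto.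
    destruct (force_requirement B Z T c1 (fst (d n)) (snd (d n))) as [c2 [H3 [H4 H5]]]; auto.
    exists c2; split; [auto|]; split; [eapply extends_trans; eauto|]; split; [|auto].
    exists e; split; [auto|]; apply H4, He. }
  assert (Hext : forall n n', n <= n' -> extends (c n) (c n')).
  { intros n n' Hle; induction Hle; [apply extends_refl|].
    eapply extends_trans; [eauto|]; apply Hc. }
  set (G := fun i => exists n, In i (chain (c n))).
  (* Every initial segment of [G] is already settled at some arbitrarily late stage. *)
  assert (Hstage : forall m n, exists N, n <= N /\
    forall i, i < m -> (G i <-> In i (chain (c N)))).
  { intros m n; induction m as [|m [N [Hle HN]]]; [exists n; split; [auto|lia]|].
    destruct (classic (G m)) as [[k Hk]|Hm].
    - exists (N + k); split; [lia|]; intros i Hi; split; [|intros H; exists (N + k); auto].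
      intros HG; destruct (Nat.eq_dec i m) as [->|Hne].
      + apply (Hext k); [lia|auto].
      + apply (Hext N); [lia|]; apply HN; [lia|auto].
    - exists N; split; [auto|]; intros i Hi; split; [|intros H; exists N; auto].
      intros HG; destruct (Nat.eq_dec i m) as [->|Hne]; [contradiction|]; apply HN; auto; lia. }
  exists G; split; [|split].
  - intros n; destruct (Hc n) as [_ [_ [[e [Hne He]] _]]]; exists e; split; [auto|].
    exists (S n); auto.
  - intros x y z Hx Hy Hz; destruct (Hstage (x + y + z + 1) 0) as [N [_ HN]].
    rewrite HN in Hx, Hy, Hz by lia.
    apply (chain_transitive T (chain (c N))); auto; apply Hc.
  - intros i a; destruct (Hd i a) as [n Hn]; destruct (Hc n) as [_ [_ [_ Hm]]].
    rewrite Hn in Hm; apply Hm; clear Hm.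
    intros m; destruct (Hstage m (S n)) as [N [Hle HN]].
    (* [f] selects the numbers below [m] that join the chain after stage [S n]; by extension they
       come from the reservoir of that stage. *)
    set (f := fun e => (e <? m) && negb (existsb (Nat.eqb e) (chain (c (S n))))).
    assert (Hf : forall e, f e = true <-> e < m /\ ~ In e (chain (c (S n)))).
    { intros e; unfold f; rewrite Bool.andb_true_iff, Nat.ltb_lt, Bool.negb_true_iff.
      rewrite <- Bool.not_true_iff_false, existsb_exists.
      assert ((exists x, In x (chain (c (S n))) /\ (e =? x) = true) <-> In e (chain (c (S n))))
        as ->; [|tauto].
      split; [intros [x [Hx Hex]]; apply Nat.eqb_eq in Hex; subst; auto|].
      intros He; exists e; split; [auto|apply Nat.eqb_refl]. }
    exists (filter f (chain (c N))); split; [|split].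
    + intros e He; apply filter_In in He as [He Hfe]; apply Hf in Hfe as [Hem Hfe].
      split; [auto|]; destruct (proj2 (proj2 (Hext _ _ Hle)) e He); tauto.
    + apply FOP_filter, Hc.
    + intros j Hj; rewrite HN by auto; rewrite in_app_iff, filter_In, Hf.
      pose proof (proj1 (proj2 (Hext _ _ Hle)) j); tauto.
Qed.

(** * A stable linear order with hyperimmune halves *)

Definition order_of (r : nat -> Q) : oracle :=
  fun k => exists x y, k = pair_code x y /\ (r x < r y)%Q.

(** For a stable order, [true] gives the [omega] part and [false] the [omega^*] part. *)
Definition half (L : oracle) (i : bool) : oracle :=
  fun x => exists y, forall z, y < z -> if i then rel L x z else rel L z x.

Definition injective_below (n : nat) (r : nat -> Q) : Prop :=
  forall x y, x < n -> y < n -> (r x == r y)%Q -> x = y.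

(** The code lies between [(x+y)^2] and [(x+y+1)^2 - 1], which determines [x + y] and then [x]. *)
Lemma pair_code_inj x y x' y' : pair_code x y = pair_code x' y' -> x = x' /\ y = y'.
Proof.
  unfold pair_code; intros H.
  assert (x + y = x' + y') by nia.
  rewrite H0 in H; lia.
Qed.

Lemma rel_order_of r x y : rel (order_of r) x y <-> (r x < r y)%Q.
Proof.
  split; [|intros H; exists x, y; auto].
  intros [x' [y' [H Hr]]]; apply pair_code_inj in H as [-> ->]; exact Hr.
Qed.

Lemma order_of_agree k r r' :
  (forall i, i < k -> r i = r' i) -> agree k (order_of r) (order_of r').
Proof.
  intros H j Hj; unfold order_of.
  split; intros [x [y [-> Hr]]]; exists x, y; split; auto; unfold pair_code in Hj;
    assert (x < k) by nia; assert (y < k) by nia; [rewrite <- !H|rewrite !H]; auto.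
Qed.

(* The first [size] elements are placed outside the open interval
   [(low, high)], into which all later elements go. *)
Record gap := Gap { place : nat -> Q; size : nat; low : Q; high : Q }.

Definition proper_gap (c : gap) : Prop :=
  (low c < high c)%Q /\ injective_below (size c) (place c) /\
  forall i, i < size c -> (place c i <= low c \/ high c <= place c i)%Q.

Definition inside (c : gap) (r : nat -> Q) : Prop :=
  (forall i, i < size c -> r i = place c i) /\
  (forall i, size c <= i -> (low c < r i < high c)%Q) /\
  forall n, injective_below n r.

Definition narrows (c c' : gap) : Prop :=
  size c <= size c' /\ (forall i, i < size c -> place c' i = place c i) /\
  (forall i, size c <= i < size c' -> (low c < place c' i < high c)%Q) /\
  (low c <= low c')%Q /\ (high c' <= high c)%Q.

(** New elements approach [low] by repeated halving. Strict decrease keeps them distinct from each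
    other, and the old elements lie outside the gap. *)
Lemma inside_exists c : proper_gap c -> exists r, inside c r.
Proof.
  intros [Hlt [Hinj Hout]].
  set (t := fix t n := match n with 0 => ((low c + high c) * (1#2))%Q
                              | S n => ((low c + t n) * (1#2))%Q end).
  assert (Ht : forall n, (low c < t n < high c)%Q).
  { induction n as [|n IH]; simpl; lra. }
  assert (Hdec : forall n m, n < m -> (t m < t n)%Q).
  { intros n m Hnm; induction Hnm as [|m Hnm IH]; simpl;
      [pose proof (Ht n)|pose proof (Ht m)]; lra. }
  exists (fun i => if i <? size c then place c i else t i); split; [|split].
  - intros i Hi; apply Nat.ltb_lt in Hi as ->; auto.
  - intros i Hi; apply Nat.ltb_ge in Hi as ->; auto.
  - intros n x y _ _; destruct (Nat.ltb_spec x (size c)) as [Hx|Hx],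
      (Nat.ltb_spec y (size c)) as [Hy|Hy]; intros E.
    + apply Hinj; auto.
    + pose proof (Hout x Hx); pose proof (Ht y); exfalso; lra.
    + pose proof (Hout y Hy); pose proof (Ht x); exfalso; lra.
    + destruct (Nat.lt_trichotomy x y) as [H|[H|H]]; [|auto|];
        apply Hdec in H; exfalso; lra.
Qed.

Lemma inside_narrows c c' r : narrows c c' -> inside c' r -> inside c r.
Proof.
  intros [Hs [Hp [Hm [Hl Hh]]]] [H1 [H2 H3]]; split; [|split; [|auto]].
  - intros i Hi; rewrite H1 by lia; auto.
  - intros i Hi; destruct (Nat.lt_ge_cases i (size c')) as [H|H].
    + rewrite H1 by lia; auto.
    + pose proof (H2 i H); lra.
Qed.

(** The gap shrinks so that the elements of [r] placed so far end up on the side opposite to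
    [half i]: above it for [i = true], where almost all numbers will be smaller, and below it
    otherwise. *)
Lemma narrow c r n i : proper_gap c -> inside c r -> size c <= n ->
  exists c', proper_gap c' /\ narrows c c' /\ size c' = n /\ place c' = r /\
    forall x, size c <= x < n -> if i : bool then (high c' <= r x)%Q else (r x <= low c')%Q.
Proof.
  intros [Hlt [Hinj Hout]] [H1 [H2 H3]] Hn.
  assert (Hb : exists a b, (low c <= a /\ a < b /\ b <= high c)%Q /\
    forall x, size c <= x < n -> if i then (b <= r x)%Q else (r x <= a)%Q).
  { clear Hn; induction n as [|n [a [b [Hab H]]]];
      [exists (low c), (high c); split; [lra|intros; lia]|].
    destruct (Nat.lt_ge_cases n (size c)) as [Hn|Hn].
    { exists a, b; split; [auto|]; intros x Hx; apply H; lia. }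
    pose proof (H2 n Hn) as Hr; destruct i.
    - destruct (Qlt_le_dec (r n) b) as [Hd|Hd].
      + exists (low c), (r n); split; [lra|]; intros x Hx.
        destruct (Nat.eq_dec x n) as [->|Hne]; [lra|].
        pose proof (H x ltac:(lia)); lra.
      + exists a, b; split; [auto|]; intros x Hx.
        destruct (Nat.eq_dec x n) as [->|Hne]; [auto|apply H; lia].
    - destruct (Qlt_le_dec a (r n)) as [Hd|Hd].
      + exists (r n), (high c); split; [lra|]; intros x Hx.
        destruct (Nat.eq_dec x n) as [->|Hne]; [lra|].
        pose proof (H x ltac:(lia)); lra.
      + exists a, b; split; [auto|]; intros x Hx.
        destruct (Nat.eq_dec x n) as [->|Hne]; [auto|apply H; lia]. }
  destruct Hb as [a [b [Hab Hside]]].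
  exists (Gap r n a b); split; [|split; [|auto]].
  - split; [simpl; lra|]; split; [apply H3|]; simpl; intros x Hx.
    destruct (Nat.lt_ge_cases x (size c)) as [Hs|Hs].
    + rewrite H1 by auto; destruct (Hout x Hs); lra.
    + specialize (Hside x (conj Hs Hx)); destruct i; auto.
  - split; [auto|]; split; [auto|]; split; [intros x [Hx _]; auto|simpl; lra].
Qed.

(** If some continuation makes [a] converge at [size c], a long enough part of it is kept with its
    new elements on the wrong side for [half i]. Otherwise [a] diverges at [size c] for all
    continuations, and one more element is placed. *)
Lemma gap_requirement c i a : proper_gap c ->
  exists c', proper_gap c' /\ narrows c c' /\ size c < size c' /\
    forall r, inside c' r -> misses (half (order_of r) i) (order_of r) a.
Proof.
  intros Hc.
  destruct (classic (exists r u, inside c r /\ W a (order_of r) [size c; u]))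
    as [[r [u [Hr HW]]]|Hn].
  - destruct (W_open a [size c; u] _ HW) as [k Hk].
    (* This length covers the use [k] and the block up to [u], and exceeds [size c]. *)
    destruct (narrow c r (S (size c + u + k)) i Hc Hr ltac:(lia))
      as [c' [Hc' [Hcc' [Hs [Hp Hside]]]]].
    exists c'; repeat (split; [auto; lia|]); intros r' Hr'.
    right; exists (size c), u; split.
    + apply Hk, order_of_agree; intros j Hj; rewrite (proj1 Hr'), Hp; auto; lia.
    + intros y Hy [z Hz].
      specialize (Hside y ltac:(lia)).
      specialize (Hz (z + size c') ltac:(lia)).
      pose proof (proj1 (proj2 Hr') (z + size c') ltac:(lia)) as Hin.
      rewrite <- Hp, <- (proj1 Hr') in Hside by lia.
      destruct i; rewrite rel_order_of in Hz; lra.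
  - destruct (inside_exists c Hc) as [r Hr].
    destruct (narrow c r (S (size c)) i Hc Hr ltac:(lia)) as [c' [Hc' [Hcc' [Hs [Hp _]]]]].
    exists c'; repeat (split; [auto; lia|]); intros r' Hr'.
    left; exists (size c); intros u Hu; apply Hn; exists r', u; split; [|auto].
    eapply inside_narrows; eauto.
Qed.

Lemma stable_order_exists : exists L,
  (forall x, ~ rel L x x) /\
  (forall x y z, rel L x y -> rel L y z -> rel L x z) /\
  (forall x y, x <> y -> rel L x y \/ rel L y x) /\
  (forall x, exists i, half L i x) /\
  hyperimmune (half L) L.
Proof.
  destruct requirement_enumeration as [d Hd].
  destruct (dependent_choice proper_gap (fun n c c' => narrows c c' /\ size c < size c' /\
      forall r, inside c' r ->
        misses (half (order_of r) (fst (d n))) (order_of r) (snd (d n)))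
    (Gap (fun _ => 0%Q) 0 0%Q 1%Q)) as [c [_ Hc]].
  { split; [simpl; lra|]; split; [intros x y Hx; simpl in Hx; lia|simpl; intros; lia]. }
  { intros n c Hc; apply gap_requirement; auto. }
  assert (Hsize : forall n, n <= size (c n)).
  { induction n as [|n IH]; [lia|]; destruct (Hc n) as [_ [_ [H _]]]; lia. }
  assert (Hnar : forall n n', n <= n' -> narrows (c n) (c n')).
  { intros n n' Hle; induction Hle as [|m Hle [I1 [I2 [I3 I4]]]].
    - split; [lia|]; split; [auto|]; split; [intros; lia|lra].
    - destruct (Hc m) as [_ [[J1 [J2 [J3 J4]]] _]].
      split; [lia|]; split; [intros i Hi; rewrite J2 by lia; auto|]; split; [|lra].
      intros i Hi; destruct (Nat.lt_ge_cases i (size (c m))) as [H|H].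
      + rewrite J2 by lia; apply I3; lia.
      + pose proof (J3 i ltac:(lia)); lra. }
  (* Stage [S i] has size at least [S i], so element [i] is already placed there. *)
  set (r := fun i => place (c (S i)) i).
  assert (Hr : forall n i, i < size (c n) -> r i = place (c n) i).
  { intros n i Hi; unfold r; destruct (Nat.le_ge_cases (S i) n) as [H|H].
    - symmetry; apply (Hnar _ _ H); pose proof (Hsize (S i)); lia.
    - apply (Hnar _ _ H); auto. }
  assert (Hin : forall n, inside (c n) r).
  { intros n; split; [auto|]; split.
    - intros i Hi; pose proof (Hsize (S i + n)) as Hs.
      rewrite (Hr (S i + n)) by lia; apply (Hnar n (S i + n)); lia.
    - intros m x y Hx Hy; pose proof (Hsize m).
      rewrite !(Hr m) by lia; apply (Hc m); lia. }
  exists (order_of r); repeat split.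
  - intros x; rewrite rel_order_of; lra.
  - intros x y z; rewrite !rel_order_of; lra.
  - intros x y Hne; rewrite !rel_order_of; destruct (Q_dec (r x) (r y)) as [[H|H]|H]; auto.
    exfalso; apply Hne; apply (proj2 (proj2 (Hin 0)) (S (x + y))); auto; lia.
  (* At stage [S x] the element [x] is placed outside the gap while all later elements fall inside
     it, hence on one side of [x]. *)
  - intros x; pose proof (Hsize (S x)) as Hs; destruct (Hin (S x)) as [_ [Htail _]].
    destruct (Hc (S x)) as [[_ [_ Hout]] _].
    specialize (Hout x Hs); rewrite <- Hr in Hout by lia.
    destruct Hout as [H|H]; [exists true|exists false]; exists (size (c (S x)));
      intros z Hz; rewrite rel_order_of; pose proof (Htail z ltac:(lia)); lra.
  - intros i a; destruct (Hd i a) as [n Hn]; destruct (Hc n) as [_ [_ [_ Hm]]].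
    rewrite Hn in Hm; apply Hm, Hin.
Qed.

(** * The model *)

Definition tower (Z : nat -> oracle) : Prop := forall n, exists X, Z (S n) = join (Z n) X.

(** Moves an operator [k] levels up a tower of joins without changing what it enumerates. *)
Fixpoint lifts (k : nat) (c : code) : code :=
  match k with 0 => c | S k => cLeft (lifts k c) end.

Lemma W_lifts Z k c : tower Z ->
  forall j l, W (lifts k c) (Z (k + j)) l <-> W c (Z j) l.
Proof.
  intros HZ; induction k as [|k IH]; intros j l; simpl; [tauto|].
  destruct (HZ (k + j)) as [X ->]; rewrite left_join; apply IH.
Qed.

Definition decides (a b : code) (Z X : oracle) : Prop :=
  forall n, (X n <-> W a Z [n]) /\ (~ X n <-> W b Z [n]).

Lemma decides_reducible X Z : (exists a b, decides a b Z X) <-> reducible X Z.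
Proof.
  split; intros [a [b H]].
  - exists (cComp a [Var 0]), (cComp b [Var 0]); intros l; apply (H (lenv l 0)).
  - exists a, b; intros n; apply (H [n]).
Qed.

(** Stage [n] codes a level [j] and two operators; if they decide a tournament from level [j], a
    solution is joined at level [n + 1]. Cantor pairing ensures [j <= n], so [lifts] can carry the
    operators to level [n]. *)
Lemma tower_exists B L : hyperimmune B L ->
  exists Z : nat -> oracle, Z 0 = L /\ (forall n, hyperimmune B (Z n)) /\ tower Z /\
    forall j T, reducible T (Z j) -> tournament_rel T ->
      exists k G, reducible G (Z k) /\ unbounded G /\
        forall x y z, G x -> G y -> G z -> rel T x y -> rel T y z -> rel T x z.
Proof.
  intros HL; destruct code_enumeration as [d Hd].
  pose (a_of := fun n => d (fst (of_nat (snd (of_nat n))))).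
  pose (b_of := fun n => d (snd (of_nat (snd (of_nat n))))).
  pose (lift_of := fun n => lifts (n - fst (of_nat n))).
  destruct (dependent_choice (hyperimmune B) (fun n Z Z' => exists G, Z' = join Z G /\
    forall T, decides (lift_of n (a_of n)) (lift_of n (b_of n)) Z T -> tournament_rel T ->
      unbounded G /\
      forall x y z, G x -> G y -> G z -> rel T x y -> rel T y z -> rel T x z) L)
    as [Z [HZ0 HZ]]; [auto| |].
  { intros n Z HB.
    destruct (classic (exists T, decides (lift_of n (a_of n)) (lift_of n (b_of n)) Z T /\
      tournament_rel T)) as [[T [HT HTt]]|Hn].
    - destruct (EM_preserves_hyperimmune B Z T) as [G [HG1 [HG2 HG3]]]; auto.
      { apply decides_reducible; eauto. }
      exists (join Z G); split; [auto|]; exists G; split; [auto|]; intros T' HT' _.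
      replace T' with T; [auto|]; apply oracle_ext; intros m.
      rewrite (proj1 (HT m)), (proj1 (HT' m)); tauto.
    (* When the stage names no tournament, joining [Z] with itself is a harmless default. *)
    - exists (join Z Z); split.
      + apply (hyperimmune_reducible B _ Z HB), reducible_join; apply reducible_refl.
      + exists Z; split; [auto|]; intros T HT HTt; exfalso; eauto. }
  assert (HJ : tower Z).
  { intros n; destruct (HZ n) as [_ [G [HG _]]]; eauto. }
  exists Z; split; [auto|]; split; [intros n; apply HZ|]; split; [auto|].
  intros j T HT HTt; apply decides_reducible in HT as [a [b Hab]].
  destruct (Hd a) as [p Hp], (Hd b) as [q Hq].
  pose (n := to_nat (j, to_nat (p, q))).
  assert (Hn : j <= n) by (pose proof (to_nat_non_decreasing j (to_nat (p, q))); unfold n; lia).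
  destruct (HZ n) as [_ [G [HG HGT]]].
  exists (S n), G; split; [rewrite HG; apply reducible_join_r|]; apply (HGT T); auto.
  unfold lift_of, a_of, b_of; unfold n at 2 3 5 6; rewrite !cancel_of_to; cbn [fst snd].
  rewrite !cancel_of_to; cbn [fst snd]; rewrite Hp, Hq.
  intros m; replace (Z n) with (Z (n - j + j)) by (f_equal; lia).
  rewrite !W_lifts by auto; apply Hab.
Qed.

(** * Verification of the axioms and of [EM], and failure of [SADS] *)

Definition in_model (Z : nat -> oracle) (X : oracle) : Prop := exists n, reducible X (Z n).

Lemma decidable_le Z S m n : tower Z -> m <= n -> decidable_in (Z m) S -> decidable_in (Z n) S.
Proof.
  intros HZ; induction 1 as [|n Hle IH]; auto; intros H.
  destruct (HZ n) as [X ->]; apply decidable_join; auto.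
Qed.

Lemma scons_lenv x l : scons x (lenv l) = lenv (x :: l).
Proof. symmetry; apply scons_eta; reflexivity. Qed.

(** Each set parameter is decidable at some level of the tower; for a compound formula the sum of
    the two levels decides both parts. *)
Lemma Delta00_decidable Z A : tower Z -> Delta00 A -> forall s, (forall i, in_model Z (s i)) ->
  exists n, decidable_in (Z n) (fun l => sat (in_model Z) (lenv l) s A).
Proof.
  intros HZ HA s Hs.
  induction HA as [t u|t u|t X| |A C HA [n IH] HC [m IH']|A C HA [n IH] HC [m IH']
    |A C HA [n IH] HC [m IH']|t A HA [n IH]|t A HA [n IH]]; cbn -[lenv].
  - exists 0; apply decidable_eq.
  - exists 0; apply decidable_lt.
  - destruct (Hs X) as [n Hn]; exists n; apply reducible_term; auto.
  - exists 0, (cLt Zero Zero), (cLt Zero One); intros l; cbn; intuition lia.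
  - exists (n + m); apply decidable_imp; eauto using decidable_le, Nat.le_add_r, Nat.le_add_l.
  - exists (n + m); apply decidable_and; eauto using decidable_le, Nat.le_add_r, Nat.le_add_l.
  - exists (n + m); apply decidable_or; eauto using decidable_le, Nat.le_add_r, Nat.le_add_l.
  - exists n; refine (decidable_ext _ _ _ _ (decidable_ball _ t _ IH)).
    intros l; split; intros H x; specialize (H x); unfold tshift in *;
      rewrite teval_tsubst, ?scons_lenv in *; exact H.
  - exists n; refine (decidable_ext _ _ _ _ (decidable_bex _ t _ IH)).
    intros l; split; intros [x H]; exists x; unfold tshift in *;
      rewrite teval_tsubst, ?scons_lenv in *; exact H.
Qed.

(** One level enumerates both the set, through the [Sigma01] form, and its complement, through the
    [Pi01] form, so the set belongs to the model. *)
Lemma models_comprehension Z A C :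
  tower Z -> Sigma01 A -> Pi01 C -> models (in_model Z) (comprehension_axiom A C).
Proof.
  intros HZ [A0 HA] [C0 HC] e s Hs HAC.
  destruct (Delta00_decidable Z A0 HZ HA s Hs) as [n Hn],
    (Delta00_decidable Z C0 HZ HC s Hs) as [m Hm].
  destruct (decidable_le Z _ n (n + m) HZ ltac:(lia) Hn) as [a [a' Ha]].
  destruct (decidable_le Z _ m (n + m) HZ ltac:(lia) Hm) as [c' [c Hc]].
  destruct (sat_local (ExN A0)) as [N HN], (sat_local (AllN C0)) as [N' HN'].
  set (l0 := map e (seq 0 (N + N'))).
  assert (Hl0 : forall x i, i < N + N' -> scons x e i = lenv (x :: l0) i).
  { intros x [|i] Hi; [reflexivity|]; unfold l0, lenv; simpl.
    rewrite nth_indep with (d' := e 0) by (rewrite length_map, length_seq; lia).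
    rewrite map_nth, seq_nth by lia; reflexivity. }
  assert (HA' : forall x, sat (in_model Z) (scons x e) s (ExN A0) <->
    exists y, W a (Z (n + m)) (y :: x :: l0)).
  { intros x; rewrite (HN (in_model Z) _ (lenv (x :: l0))) by (intros; apply Hl0; lia).
    simpl; setoid_rewrite scons_lenv.
    split; intros [y Hy]; exists y; apply (Ha (y :: x :: l0)); auto. }
  assert (HC' : forall x, ~ sat (in_model Z) (scons x e) s (AllN C0) <->
    exists y, W c (Z (n + m)) (y :: x :: l0)).
  { intros x; rewrite (HN' (in_model Z) _ (lenv (x :: l0))) by (intros; apply Hl0; lia).
    simpl; setoid_rewrite scons_lenv; split.
    - intros H; apply not_all_ex_not in H as [y Hy]; exists y; apply (Hc (y :: x :: l0)); auto.
    - intros [y Hy] H; apply (Hc (y :: x :: l0)) in Hy; apply Hy, H. }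
  exists (fun x => sat (in_model Z) (scons x e) s (ExN A0)); split.
  - exists (n + m); apply decides_reducible.
    (* The number parameters [l0] are hard-wired into the operator as numerals. *)
    pose (g := fun q => cEx (cComp q (Var 0 :: Var 1 :: map num l0))).
    assert (Hg : forall q x, W (g q) (Z (n + m)) [x] <->
      exists y, W q (Z (n + m)) (y :: x :: l0)).
    { intros q x; unfold g; cbn [W].
      assert (E : forall y, map (teval (lenv [y; x])) (Var 0 :: Var 1 :: map num l0) =
        y :: x :: l0).
      { intros y; cbn [map]; rewrite map_map; do 2 f_equal.
        erewrite map_ext; [apply map_id|]; intros; apply teval_num. }
      split; intros [y Hy]; exists y; rewrite E in *; exact Hy. }
    exists (g a), (g c); intros x; rewrite !Hg, <- HA', <- HC'.
    split; [tauto|]; pose proof (HAC x); simpl in *; tauto.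
  - intros x; split; intros H.
    + apply (sat_shiftS _ _ (scons x e) s (ExN A0)), H.
    + apply sat_shiftS in H; exact H.
Qed.

(** The number sort is the standard [nat], so induction can be done outside the model. *)
Lemma models_induction M A : models M (induction_axiom A).
Proof.
  intros e s _ [H0 HS] x; induction x as [|x IH].
  - apply sat_instN in H0; exact H0.
  - specialize (HS x IH); unfold succ_inst in HS; rewrite sat_subst in HS.
    match type of HS with sat _ ?f _ _ => rewrite (scons_eta (S x) e f) in HS end;
      [exact HS|simpl; lia|reflexivity].
Qed.

Lemma models_RCA0 Z A : tower Z -> RCA0 A -> models (in_model Z) A.
Proof.
  intros HZ [| | | | | | | |A' _|A' C HA HC]; try (intros e s _; simpl; lia).
  - apply models_induction.
  - apply models_comprehension; auto.
Qed.

Lemma models_EM M :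
  (forall T, M T -> tournament_rel T -> exists G, M G /\ unbounded G /\
    forall x y z, G x -> G y -> G z -> rel T x y -> rel T y z -> rel T x z) ->
  models M EM.
Proof.
  intros H e s _ T HT HTt; destruct (H T HT HTt) as [G [HG [HGu HGt]]].
  exists G; split; [exact HG|]; split; [exact HGu|].
  intros x y z [Hx [Hy Hz]] [Hxy Hyz]; exact (HGt x y z Hx Hy Hz Hxy Hyz).
Qed.

Lemma EM_implies_SEM M : models M EM -> models M SEM.
Proof. intros H e s Hs T HT [HTt _]; exact (H e s Hs T HT HTt). Qed.

Lemma ADS_implies_SADS M e s : sat M e s ADS -> sat M e s SADS.
Proof. intros H T HT [HTt _]; exact (H T HT HTt). Qed.

(* A monotone sequence in [L] has unbounded range inside one half, so searching
   its range for an element above [x] contradicts hyperimmunity of that half. *)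
Lemma SADS_fails (Z : nat -> oracle) L :
  (forall x, ~ rel L x x) ->
  (forall x y z, rel L x y -> rel L y z -> rel L x z) ->
  (forall x y, x <> y -> rel L x y \/ rel L y x) ->
  (forall x, exists i, half L i x) ->
  in_model Z L -> (forall n, hyperimmune (half L) (Z n)) ->
  forall e s, ~ sat (in_model Z) e s SADS.
Proof.
  intros Hirr Htrans Htot Hhalf HL HZ e s H.
  destruct (H L HL) as [F [[n HF] [Hfun Hmon]]].
  { split; [split; [exact Hirr|split]|].
    - intros x y z [Hxy Hyz]; exact (Htrans x y z Hxy Hyz).
    - exact Htot.
    - intros x; destruct (Hhalf x) as [[] [y Hy]]; exists y; [left|right]; exact Hy. }
  clear H.
  assert (Hf : exists f, forall k, rel F k (f k)).
  { apply functional_choice; intros k; destruct (Hfun k) as [a [Ha _]]; exists a; exact Ha. }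
  destruct Hf as [f Hf].
  assert (Hi : exists i, forall k m, k < m ->
    if i : bool then rel L (f k) (f m) else rel L (f m) (f k)).
  { destruct Hmon as [Hmon|Hmon]; [exists true|exists false]; intros k m Hkm;
      exact (Hmon k m (f k) (f m) Hkm (Hf k) (Hf m)). }
  clear Hmon; destruct Hi as [i Hi].
  assert (Hinj : forall k m, k < m -> f k <> f m).
  { intros k m Hkm E; specialize (Hi k m Hkm); rewrite E in Hi.
    destruct i; exact (Hirr _ Hi). }
  assert (Hunb : forall x k, exists m, k < m /\ x < f m).
  { intros x k; apply NNPP; intros Hn.
    assert (Hle : forall m, f (k + 1 + m) <= x).
    { intros m; apply Nat.nlt_ge; intros Hx; apply Hn; exists (k + 1 + m); split; [lia|auto]. }
    (* These are [x + 2] distinct values, too many for the [x + 1] numbers up to [x]. *)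
    set (g := map (fun m => f (k + 1 + m)) (seq 0 (x + 2))).
    assert (Hg : NoDup g).
    { apply NoDup_map_NoDup_ForallPairs; [|apply seq_NoDup].
      intros a b _ _ E; destruct (Nat.lt_trichotomy a b) as [Hab|[Hab|Hab]]; auto; exfalso.
      - apply (Hinj (k + 1 + a) (k + 1 + b)); [lia|auto].
      - apply (Hinj (k + 1 + b) (k + 1 + a)); [lia|auto]. }
    assert (Hl : length g <= length (seq 0 (x + 1))).
    { apply NoDup_incl_length; auto; intros y Hy; apply in_map_iff in Hy as [m [<- _]].
      apply in_seq; specialize (Hle m); lia. }
    unfold g in Hl; rewrite length_map, !length_seq in Hl; lia. }
  (* Almost all numbers lie on one side of [f k], including a later term of the sequence; the
     direction of the sequence then tells which side. *)
  assert (Hin : forall k, half L i (f k)).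
  { intros k; destruct (Hhalf (f k)) as [j [y Hy]].
    destruct (Hunb y k) as [m [Hkm Hym]]; pose proof (Hy (f m) Hym) as Hym'.
    specialize (Hi k m Hkm).
    destruct i, j; try (exists y; exact Hy); exfalso; eapply Hirr, Htrans; eauto. }
  destruct (proj2 (decides_reducible _ _) HF) as [q [q' Hq]].
  pose (t := Add (Mul (Add (Var 1) (Var 0)) (Add (Var 1) (Var 0))) (Var 1)).
  (* [c] accepts [u] at [x] if the range of the sequence meets [(x, u]]. *)
  pose (c := cEx (cEx (cAnd (cComp q [t])
    (cAnd (cLt (Var 2) (Var 0)) (cLt (Var 0) (Add (Var 3) One)))))).
  assert (Hc : forall x u, W c (Z n) [x; u] <-> exists k a, rel F k a /\ x < a /\ a < u + 1).
  { intros x u; cbn; split; intros [k [a [Ha Hxu]]]; exists k, a; split; auto; apply Hq, Ha. }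
  destruct (HZ n i c) as [[x Hx]|[x [u [Hxu Hy]]]].
  - destruct (Hunb x 0) as [m [_ Hm]]; apply (Hx (f m)), Hc; exists m, (f m).
    split; [apply Hf|lia].
  - apply Hc in Hxu as [k [a [Ha Hxa]]]; apply (Hy a); [lia|].
    destruct (Hfun k) as [a' [_ Huniq]].
    replace a with (f k); [apply Hin|].
    transitivity a'; [exact (Huniq _ (Hf k))|symmetry; exact (Huniq _ Ha)].
Qed.

Theorem corollary1p16 :
  ~ implies_over RCA0 EM SADS /\
  ~ implies_over RCA0 EM ADS /\
  ~ implies_over RCA0 SEM ADS /\
  ~ implies_over RCA0 SEM SADS.
Proof.
  destruct stable_order_exists as [L [Hirr [Htrans [Htot [Hhalf HL]]]]].
  destruct (tower_exists (half L) L HL) as [Z [HZ0 [HZ [Htower HEM]]]].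
  assert (HLM : in_model Z L) by (exists 0; rewrite HZ0; apply reducible_refl).
  pose proof (SADS_fails Z L Hirr Htrans Htot Hhalf HLM HZ) as HSADS.
  assert (HM : models (in_model Z) EM).
  { apply models_EM; intros T [j HT] HTt; destruct (HEM j T HT HTt) as [k [G [HG HGT]]].
    exists G; split; [exists k|]; auto. }
  pose proof (EM_implies_SEM _ HM) as HM'.
  (* Soundness is applied in an environment that reads every set variable as [L], a member of the
     model. *)
  assert (Hsound : forall A C, models (in_model Z) A -> implies_over RCA0 A C ->
    sat (in_model Z) (fun _ => 0) (fun _ => L) C).
  { intros A C HA HAC.
    apply (soundness _ _ _ _ (fun C => models_RCA0 Z C Htower) HAC _ (fun _ => L) (fun _ => HLM)).
    - intros C' [].
    - apply HA; auto. }
  assert (HADS : forall e s, ~ sat (in_model Z) e s ADS).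
  { intros e s H; apply (HSADS e s), ADS_implies_SADS, H. }
  repeat split; intros H; apply Hsound in H; auto;
    solve [eapply HSADS; exact H | eapply HADS; exact H].
Qed.
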